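(* Let $n \geq 4$. There is no constant $C<\infty$ such that $$\big\| e^{it|D|} u \big\|_{L^2_t L^\infty_x(\mathbb{R}\times\mathbb{R}^n)} \leq C \, \|u\|_{\dot H^{\frac{n-1}{2}}(\mathbb{R}^n)}$$ holds for all Schwartz functions $u \in \mathcal{S}(\mathbb{R}^n)$.
   Context: For $u\in\mathcal S(\mathbb R^n)$, $e^{it|D|}u$ is defined via the Fourier transform by $\widehat{e^{it|D|}u}(\xi) = e^{it|\xi|}\hat u(\xi)$; it solves the wave equation $(-\partial_t^2+\Delta)v=0$. The homogeneous Sobolev norm is $\|u\|_{\dot H^s} = \||\xi|^s \hat u(\xi)\|_{L^2_\xi}$ (up to the normalization of the Fourier transform). The space-time norm is $\|F\|_{L^2_tL^\infty_x}^2 = \int_{-\infty}^{\infty} \|F(t,\cdot)\|_{L^\infty(\mathbb R^n)}^2\,dt$. *)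

(* Defs.v *)
From mathcomp Require Import all_boot all_algebra.
From mathcomp Require Import all_classical all_reals all_analysis.
From mathcomp Require Import complex.
Import GRing.Theory Num.Theory.
Local Open Scope ring_scope.
Local Open Scope classical_set_scope.

Set Implicit Arguments. Unset Strict Implicit. Unset Printing Implicit Defensive.

Section wave_defs.
Variable R : realType.

Definition dotR (n : nat) (x y : 'rV[R]_n) : R := \sum_(i < n) x 0 i * y 0 i.
Definition enorm (n : nat) (x : 'rV[R]_n) : R := Num.sqrt (\sum_(i < n) x 0 i ^+ 2).

(* Lebesgue integral over R^n of a real function, computed as an iterated
   one-dimensional Lebesgue integral (Fubini; all integrands used below are
   integrable).  R^(n+1) = R x R^n via row_mx. *)
Fixpoint iterint (n : nat) : ('rV[R]_n -> R) -> R :=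
  match n return ('rV[R]_n -> R) -> R with
  | 0 => fun g => g 0
  | n'.+1 => fun g =>
      Rintegral (@lebesgue_measure R) setT
        (fun x : R => @iterint n' (fun y : 'rV[R]_n' => g (row_mx (\row_(j < 1) x) y)))
  end.

Definition cint (n : nat) (f : 'rV[R]_n -> R[i]) : R[i] :=
  Complex (iterint (fun x => complex.Re (f x))) (iterint (fun x => complex.Im (f x))).

Definition expi (theta : R) : R[i] := Complex (cos theta) (sin theta).

Definition cmod (z : R[i]) : R := Num.sqrt (complex.Re z ^+ 2 + complex.Im z ^+ 2).

Definition fourier (n : nat) (u : 'rV[R]_n -> R[i]) (xi : 'rV[R]_n) : R[i] :=
  cint (fun x => expi (- dotR x xi) * u x).

Definition wave (n : nat) (t : R) (u : 'rV[R]_n -> R[i]) (x : 'rV[R]_n) : R[i] :=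
  Complex (((2 * pi) ^- n) : R) 0 *
  cint (fun xi => expi (dotR x xi) * expi (t * enorm xi) * fourier u xi).

Definition Hdot_norm (n : nat) (s : R) (u : 'rV[R]_n -> R[i]) : R :=
  Num.sqrt (iterint (fun xi => (enorm xi `^ s * cmod (fourier u xi)) ^+ 2)).

Definition L2Linf_norm (n : nat) (F : R -> 'rV[R]_n -> R[i]) : \bar R :=
  sqrte (\int[@lebesgue_measure R]_(t in setT)
           ((ereal_sup [set (cmod (F t x))%:E | x in [set: 'rV[R]_n]]) ^+ 2)%E).

Definition unit_vec (n : nat) (i : 'I_n) : 'rV[R]_n := delta_mx 0 i.

Fixpoint iter_partial (n : nat) (beta : seq 'I_n) (f : 'rV[R]_n -> R)
    : 'rV[R]_n -> R :=
  match beta with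
  | [::] => f
  | i :: beta' => fun x => derive (iter_partial beta' f) x (unit_vec i)
  end.

Definition schwartzR (n : nat) (f : 'rV[R]_n -> R) : Prop :=
  forall beta : seq 'I_n,
    (forall (x : 'rV[R]_n) (i : 'I_n), derivable (iter_partial beta f) x (unit_vec i))
    /\ (forall k : nat, exists M : R, forall x : 'rV[R]_n,
          (1 + enorm x ^+ 2) ^+ k * `|iter_partial beta f x| <= M).

Definition schwartz (n : nat) (u : 'rV[R]_n -> R[i]) : Prop :=
  schwartzR (fun x => complex.Re (u x)) /\ schwartzR (fun x => complex.Im (u x)).

End wave_defs.

(* Main.v *)
(**
Take [u] to be the Gaussian times a trigonometric polynomial, so that
[u^ = sum_i a_i exp(-|xi - p_i|^2/2)] up to a constant. Restrict the wave to the superluminal line [x = t V] with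
[V = sqrt 2 e_0]: there the phase is [t (|xi| + V.xi)], which vanishes on the cone
[xi_0 = - |xi'|]. If all [p_i] lie on this cone, the phase stays bounded on the
bulk of each Gaussian, so [Re (wave t u (t V))] is at least [S / 2] with
[S = sum_i a_i], for all [t] in a fixed neighbourhood of [0]. Taking the points
[p_i] above a lattice of [R^(n-1)] makes the Gaussians almost orthogonal; with
[a_i = |p_i|^(1-n)] the squared Sobolev norm is then at most a constant times
[S]. The estimate would give [S^2 <= const * S], whereas [S] is comparable to a
partial sum of the harmonic series.
*)

Require Import Defs.
From mathcomp Require Import all_boot all_order all_algebra.
From mathcomp Require Import all_classical all_reals all_analysis.
From mathcomp Require Import measurable_realfun lebesgue_integral_under.
From mathcomp Require Import complex.
From mathcomp Require Import ring lra.
Import Order.TTheory GRing.Theory Num.Theory.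
Import numFieldNormedType.Exports.
Local Open Scope ring_scope.
Local Open Scope classical_set_scope.

Set Implicit Arguments. Unset Strict Implicit. Unset Printing Implicit Defensive.

(** * Gaussians on the line *)

Section gaussian_line.
Variable R : realType.
Local Notation mu := (@lebesgue_measure R).

(** A superluminal [V] makes the zero set of the phase large: for [|V| = 1] it is a single ray,
    along which [sum |p_i|^(1-n)] over unit-spaced points converges, whereas for [|V| > 1] it is a
    cone of dimension [n - 1]. The lattice of [R^(n-1)] has about [j^(n-2)] points at height [j],
    each of weight comparable to [j^(1-n)], hence [1/j] per layer. The exponent in [a_i] is chosen
    so that [a_i^2 |p_i|^(n-1) = a_i], which makes the bound on the squared Sobolev norm linear in
    the [a_i]. Fourier inversion does not enter: the transform of the packet is explicit, and the
    wave is an integral of it, bounded from below.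

    [iterint] iterates [Rintegral], so linearity and monotonicity require every partial integral to
    be integrable. All integrands are therefore kept in one class: continuous functions bounded by a
    multiple of [exp(-|x|^2/8)]. Three rates occur: [1/2] for the packets, [1/4] once half of a
    Gaussian has been spent on a polynomial factor, and [1/8] for the envelope centred at 0, which
    absorbs translations. *)

Definition gauss (b x : R) : R := expR (- (b * x ^+ 2)).

Lemma gauss_gt0 b x : 0 < gauss b x.
Proof. exact: expR_gt0. Qed.

Lemma gauss_ge0 b x : 0 <= gauss b x.
Proof. exact: expR_ge0. Qed.

Lemma continuous_gauss b m : continuous (fun x => gauss b (x - m)).
Proof.
move=> x; rewrite /gauss; apply: continuous_comp; last exact: continuous_expR.
apply: cvgN; apply: cvgM; first exact: cvg_cst.
have h : (fun y : R => y - m) y @[y --> x] --> x - m.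
  by apply: cvgB; [exact: cvg_id|exact: cvg_cst].
by rewrite expr2; under eq_fun do rewrite expr2; apply: cvgM.
Qed.

(** This is the normal density of mean [m] and variance [1/(2b)]; integrability and total mass are
    read off from it. *)
Lemma gauss_normal_pdf b m x : 0 < b ->
  gauss b (x - m) = Num.sqrt (pi / b) * normal_pdf m (Num.sqrt (2 * b)^-1) x.
Proof.
move=> b0.
have s0 : 0 < Num.sqrt (2 * b)^-1 by rewrite sqrtr_gt0 invr_gt0; lra.
have s2 : Num.sqrt (2 * b)^-1 ^+ 2 = (2 * b)^-1.
  by rewrite sqr_sqrtr// invr_ge0; lra.
rewrite normal_pdfE ?gt_eqF//= /normal_peak /normal_fun s2.
have -> : (2 * b)^-1 * pi *+ 2 = pi / b.
  by rewrite -mulr_natr; field; rewrite gt_eqF.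
have p0 : Num.sqrt (pi / b) != 0.
  by rewrite gt_eqF// sqrtr_gt0 divr_gt0// pi_gt0.
rewrite mulrA divff// mul1r /gauss; congr expR.
by rewrite -mulr_natr; field; rewrite gt_eqF.
Qed.

Lemma integrable_gauss b m : 0 < b ->
  mu.-integrable setT (EFin \o (fun x => gauss b (x - m))).
Proof.
move=> b0.
have -> : EFin \o (fun x => gauss b (x - m)) =
   fun x => ((Num.sqrt (pi / b))%:E * (normal_pdf m (Num.sqrt (2 * b)^-1) x)%:E)%E.
  by apply/funext => x /=; rewrite gauss_normal_pdf.
by apply: integrableZl => //; exact: integrable_normal_pdf.
Qed.

Lemma Rintegral_gauss b m : 0 < b ->
  \int[mu]_x gauss b (x - m) = Num.sqrt (pi / b).
Proof.
move=> b0.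
under eq_Rintegral do rewrite gauss_normal_pdf//.
rewrite RintegralZl//; last exact: integrable_normal_pdf.
by rewrite /Rintegral integral_normal_pdf mulr1.
Qed.

Lemma gauss_dominated_integrable (C b : R) (h : R -> R) : 0 < b ->
  measurable_fun setT h -> (forall x, `|h x| <= C * gauss b x) ->
  mu.-integrable setT (EFin \o h).
Proof.
move=> b0 mh hC.
have i1 := integrableZl measurableT C (integrable_gauss 0 b0).
apply: (le_integrable _ _ _ i1) => //=; first exact/measurable_EFinP.
move=> x _; rewrite lee_fin subr0; apply: le_trans (hC x) _.
exact: ler_norm.
Qed.

Lemma Rintegral_dominated_cvg (C b : R) (h : nat -> R -> R) (l : R -> R) : 0 < b ->
  (forall k, measurable_fun setT (h k)) ->
  (forall k x, `|h k x| <= C * gauss b x) ->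
  (forall x, h k x @[k --> \oo] --> l x) ->
  \int[mu]_x h k x @[k --> \oo] --> \int[mu]_x l x.
Proof.
move=> b0 mh hC hl.
have ml : measurable_fun setT l by apply: measurable_fun_cvg mh _ => x _; exact: hl.
have lC x : `|l x| <= C * gauss b x.
  have h2 : `|h k x| @[k --> \oo] --> `|l x| by exact: cvg_norm (hl x).
  by apply: (cvgr_to_le h2); exact: nearW.
apply: fine_cvg.
rewrite /Rintegral fineK; last first.
  apply: integrable_fin_num => //; exact: gauss_dominated_integrable lC.
apply: (@dominated_cvg _ _ _ mu setT measurableT
   (fun n x => (h n x)%:E) _ (EFin \o (fun x => C * gauss b x))) => //.
- by move=> n; apply/measurable_EFinP; exact: mh.
- by move=> x _; apply: cvg_EFin; [exact: nearW|exact: hl].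
- apply: (@gauss_dominated_integrable `|C| b) => //.
    apply: continuous_measurable_fun => x; apply: cvgM; first exact: cvg_cst.
    have := @continuous_gauss b 0 x; under eq_fun do rewrite subr0.
    by apply.
  by move=> x; rewrite normrM ler_wpM2l// ger0_norm// gauss_ge0.
- by move=> n x _; rewrite lee_fin.
Qed.

(** Fundamental theorem of calculus on growing intervals: the Gaussian bound kills the boundary
    values of [h], and the truncated integrals converge by domination. This serves as integration by
    parts on the line. *)
Lemma Rintegral_derive_gauss0 (C b : R) (h h' : R -> R) : 0 < b ->
  (forall x : R, is_derive x (1 : R) h (h' x)) -> continuous h' ->
  (forall x, `|h x| <= C * gauss b x) ->
  (forall x, `|h' x| <= C * gauss b x) ->
  \int[mu]_x h' x = 0.
Proof.
move=> b0 dh ch' hC h'C.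
(* [n.+1] keeps the interval nondegenerate at [n = 0], as [continuous_FTC2] asks. *)
pose I (n : nat) : set R := `[- n.+1%:R, n.+1%:R].
have c1 : \int[mu]_x (h' \_ (I n)) x @[n --> \oo] --> \int[mu]_x h' x.
  apply: (@Rintegral_dominated_cvg C b) => //.
  - move=> n; apply/(measurable_restrictT _ _).1 => //.
      exact: measurable_itv.
    by apply: measurable_funTS; exact: continuous_measurable_fun.
  - move=> n x; rewrite /patch; case: ifP => // _.
    by rewrite normr0; apply: le_trans (hC x).
  - move=> x.
    apply: cvg_near_cst.
    near=> n; rewrite /patch ifT// inE /I/= in_itv/= -ler_norml.
    have : `|x| <= n%:R by near: n; exact: nbhs_infty_ger.
    by move=> /le_trans; apply; rewrite ler_nat.
have c2 : \int[mu]_x (h' \_ (I n)) x @[n --> \oo] --> (0 : R).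
  have e n : \int[mu]_x (h' \_ (I n)) x = h n.+1%:R - h (- n.+1%:R).
    rewrite -Rintegral_mkcond /Rintegral (@continuous_FTC2 _ h' h)//.
    - by rewrite (@lt_trans _ _ 0)// ?oppr_lt0.
    - exact: continuous_subspaceT.
    - have ch : continuous h.
        by move=> x; apply/differentiable_continuous/derivable1_diffP; case: (dh x).
      split.
      + by move=> x _; case: (dh x).
      + by apply: cvg_at_right_filter; exact: ch.
      + by apply: cvg_at_left_filter; exact: ch.
    - by move=> x _; rewrite derive1E; case: (dh x).
  (* With [N = n.+1], [exp(b N^2) >= b N^2 >= b N], so the harmonic sequence dominates. *)
  have g0 : gauss b n.+1%:R @[n --> \oo] --> (0 : R).
    apply: (@squeeze_cvgr _ _ _ _ (fun=> 0) (fun n => b^-1 * n.+1%:R^-1)).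
    - near=> n; rewrite gauss_ge0//= /gauss expRN.
      rewrite -invfM lef_pV2 ?posrE ?expR_gt0 ?mulr_gt0 ?ltr0n//.
      apply: le_trans (expR_ge1Dx _); rewrite ler_wpDl//.
      by rewrite ler_wpM2l ?(ltW b0)// expr2 ler_peMr// ler1n.
    - exact: cvg_cst.
    - rewrite -[X in _ --> X](mulr0 b^-1); apply: cvgM; first exact: cvg_cst.
      exact: cvg_harmonic.
  have g1 : C * gauss b n.+1%:R @[n --> \oo] --> (0 : R).
    by rewrite -[X in _ --> X](mulr0 C); apply: cvgM => //; exact: cvg_cst.
  rewrite (_ : (fun n => _) = (fun n => h n.+1%:R - h (- n.+1%:R))); last first.
    exact/funext.
  rewrite -[X in _ --> X](subrr 0); apply: cvgB.
    apply: norm_cvg0.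
    apply: (@squeeze_cvgr _ _ _ _ (fun=> 0) (fun n => C * gauss b n.+1%:R)) => //.
      by near=> n; rewrite normr_ge0 hC.
    exact: cvg_cst.
  apply: norm_cvg0.
  apply: (@squeeze_cvgr _ _ _ _ (fun=> 0) (fun n => C * gauss b n.+1%:R)) => //.
    near=> n; rewrite normr_ge0 /=; apply: le_trans (hC _) _.
    by rewrite /gauss sqrrN.
  exact: cvg_cst.
exact: (cvg_unique _ c1 c2).
Unshelve. all: by end_near. Qed.

End gaussian_line.

(** * Fourier transform of the Gaussian in dimension one *)

Section gaussian_fourier.
Variable R : realType.
Local Notation mu := (@lebesgue_measure R).

(** Half of the exponent pays for the polynomial factor: [|x| <= 2 (1 + x^2/4) <= 2 exp(x^2/4)]. The
    same split recurs in [sqn_vgauss_le] and [enorm_vgauss_le]. *)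
Lemma normr_mul_gauss_le (x : R) : `|x| * gauss 2^-1 x <= 2 * gauss 4^-1 x.
Proof.
have -> : gauss 2^-1 x = gauss 4^-1 x * gauss 4^-1 x.
  by rewrite /gauss -expRD; congr expR; field.
rewrite mulrA ler_pM2r ?gauss_gt0// /gauss expRN.
rewrite ler_pdivrMr ?expR_gt0//.
have h := expR_ge1Dx (4^-1 * x ^+ 2).
have : `|x| <= 2 * (1 + 4^-1 * x ^+ 2).
  by rewrite -(real_normK (num_real x)); nra.
by move=> /le_trans; apply; rewrite ler_pM2l.
Qed.

Lemma gauss_half_le (x : R) : gauss 2^-1 x <= gauss 4^-1 x.
Proof. by rewrite /gauss ler_expR lerN2; have := sqr_ge0 x; nra. Qed.

Lemma is_derive_gauss (b x : R) : is_derive x (1 : R) (gauss b) (- (2 * b * x) * gauss b x).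
Proof.
rewrite /gauss; apply: trigger_derive.
by rewrite /GRing.scale/=; ring.
Qed.

Lemma is_derive_gauss_sin (p theta x : R) :
  is_derive x (1 : R) (fun x => gauss 2^-1 x * sin (x * p + theta))
    (p * (gauss 2^-1 x * cos (x * p + theta)) +
     - (x * gauss 2^-1 x * sin (x * p + theta))).
Proof.
by rewrite /gauss; apply: trigger_derive; rewrite /GRing.scale/=; field.
Qed.

(** As a function [F] of the frequency, the integral solves [F' = - q F]: differentiation under the
    integral sign produces the factor [- x sin], and integration by parts turns that into [- q F].
    The solution is fixed by its value at 0, the mass of the Gaussian times [cos theta]. *)
Lemma Rintegral_gauss_cos (q theta : R) :
  \int[mu]_x (gauss 2^-1 x * cos (x * q + theta)) =
  Num.sqrt (2 * pi) * gauss 2^-1 q * cos theta.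
Proof.
pose f (q x : R) := gauss 2^-1 x * cos (x * q + theta).
pose f' (q x : R) := - (x * gauss 2^-1 x * sin (x * q + theta)).
have dfq (p x : R) : is_derive p (1 : R) (f ^~ x) (f' p x).
  rewrite /f /f'; apply: trigger_derive; rewrite /GRing.scale/=; ring.
have contf p : continuous (f p).
  move=> x; apply: cvgM.
    by have := @continuous_gauss R 2^-1 0 x; under eq_fun do rewrite subr0; apply.
  apply: continuous_comp; last exact: continuous_cos.
  by apply: cvgD; [apply: cvgM; [exact: cvg_id|exact: cvg_cst]|exact: cvg_cst].
have contf' p : continuous (f' p).
  move=> x; apply: cvgN; apply: cvgM; first apply: cvgM; first exact: cvg_id.
    by have := @continuous_gauss R 2^-1 0 x; under eq_fun do rewrite subr0; apply.
  apply: continuous_comp; last exact: continuous_sin.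
  by apply: cvgD; [apply: cvgM; [exact: cvg_id|exact: cvg_cst]|exact: cvg_cst].
have bf p x : `|f p x| <= 1 * gauss 4^-1 x.
  rewrite /f normrM mul1r ger0_norm ?gauss_ge0//.
  apply: le_trans (gauss_half_le x); rewrite ler_piMr ?gauss_ge0//.
  by rewrite ler_norml cos_geN1 cos_le1.
have bf' p x : `|f' p x| <= 2 * gauss 4^-1 x.
  rewrite /f' normrN !normrM (ger0_norm (ltW (gauss_gt0 _ _))).
  apply: le_trans (normr_mul_gauss_le x); rewrite ler_piMr//.
    by rewrite mulr_ge0// gauss_ge0.
  by rewrite ler_norml sin_geN1 sin_le1.
have q4 : (0 : R) < 4^-1 by lra.
have intf p : mu.-integrable setT (EFin \o f p).
  by apply: gauss_dominated_integrable (bf p) => //; exact: continuous_measurable_fun.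
have intf' p : mu.-integrable setT (EFin \o f' p).
  by apply: gauss_dominated_integrable (bf' p) => //; exact: continuous_measurable_fun.
pose F p := \int[mu]_x f p x.
have dF (p : R) : is_derive p (1 : R) F (\int[mu]_x f' p x).
  have I0 : (`]p - 1, p + 1[ : set R)%classic p by rewrite /= in_itv/=; apply/andP; split; lra.
  have H1 (x y : R) : (`]p - 1, p + 1[ : set R)%classic x -> [set: R] y -> derivable (f ^~ y) x 1.
    by move=> _ _; case: (dfq x y).
  have H2 (x y : R) : (`]p - 1, p + 1[ : set R)%classic x -> [set: R] y ->
      `|partial1of2 f x y| <= 2 * gauss 4^-1 y.
    by move=> _ _; rewrite partial1of2E; case: (dfq x y) => _ ->.
  have H3 : mu.-integrable setT (EFin \o (fun x => 2 * gauss 4^-1 x)).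
    have := integrableZl measurableT 2 (integrable_gauss 0 q4).
    by apply: eq_integrable => // x _ /=; rewrite subr0.
  have H4 (y : R) : 0 <= 2 * gauss 4^-1 y by rewrite mulr_ge0// gauss_ge0.
  have H0 (x : R) (_ : (`]p - 1, p + 1[ : set R)%classic x) := intf x.
  apply: DeriveDef.
    exact: (derivable_under_integral measurableT I0 H0 H1 H4 H3 H2).
  rewrite -derive1E (differentiation_under_integral measurableT I0 H0 H1 H4 H3 H2).
  by apply: eq_Rintegral => x _; rewrite partial1of2E; case: (dfq p x).
have E p : \int[mu]_x f' p x = - p * F p.
  pose h (x : R) := gauss 2^-1 x * sin (x * p + theta).
  pose h' (x : R) := p * f p x + f' p x.
  have dh (x : R) : is_derive x (1 : R) h (h' x).
    exact: is_derive_gauss_sin.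
  have ch' : continuous h'.
    move=> x; apply: cvgD; last exact: contf'.
    by apply: cvgM; [exact: cvg_cst|exact: contf].
  have bh x : `|h x| <= (`|p| + 2) * gauss 4^-1 x.
    rewrite /h normrM (ger0_norm (gauss_ge0 _ _)).
    have h1 := gauss_half_le x; have h2 := gauss_ge0 2^-1 x; have h3 := normr_ge0 p.
    have : `|sin (x * p + theta)| <= 1 by rewrite ler_norml sin_geN1 sin_le1.
    have := normr_ge0 (sin (x * p + theta)).
    by move: (`|sin _|) (`|p|) h3 => s a *; nra.
  have bh' x : `|h' x| <= (`|p| + 2) * gauss 4^-1 x.
    apply: le_trans (ler_normD _ _) _; rewrite mulrDl lerD//.
    by rewrite normrM ler_wpM2l//; have := bf p x; rewrite mul1r.
  have := Rintegral_derive_gauss0 q4 dh ch' bh bh'; rewrite /h'.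
  rewrite RintegralD//; last first.
    by have := integrableZl measurableT p (intf p); apply: eq_integrable.
  rewrite RintegralZl// -/(F p) addrC => /eqP; rewrite addr_eq0 => /eqP ->.
  by rewrite mulNr.
(* [gauss (- 2^-1) p] is [exp(p^2/2)], the integrating factor of the equation. *)
pose G p := F p * gauss (- 2^-1) p.
have GE : G q = G 0.
  apply: is_derive_0_is_cst => p; rewrite /G.
  have h1 := dF p; rewrite E in h1; have h2 := is_derive_gauss (- 2^-1) p.
  by apply: (is_derive_eq (is_deriveM h1 h2)); rewrite /GRing.scale/=; field.
have G0 : G 0 = Num.sqrt (2 * pi) * cos theta.
  rewrite /G {1}/gauss expr0n/= mulr0 oppr0 expR0 mulr1 /F /f.
  rewrite -[X in _ = X * _](_ : \int[mu]_x (gauss 2^-1 x) = _); last first.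
    rewrite -[RHS](_ : Num.sqrt (pi / 2^-1) = _); last by rewrite invrK mulrC.
    by rewrite -(@Rintegral_gauss _ 2^-1 0)//; apply: eq_Rintegral => x _; rewrite subr0.
  rewrite mulrC -RintegralZl//; last first.
    have : 0 < 2^-1 :> R by lra.
    move/(integrable_gauss 0); apply: eq_integrable => // x _ /=; by rewrite subr0.
  by apply: eq_Rintegral => x _; rewrite mulr0 add0r mulrC.
rewrite -[LHS]/(F q).
have -> : F q = G q * gauss 2^-1 q.
  rewrite /G -mulrA /gauss -expRD mulNr opprK subrr expR0 mulr1 //.
by rewrite GE G0 mulrAC.
Qed.

End gaussian_fourier.

(** * Iterated integrals of functions with Gaussian decay *)

Section iterated_integral.
Variable R : realType.
Local Notation mu := (@lebesgue_measure R).

Definition sqn n (x : 'rV[R]_n) : R := \sum_(i < n) x 0 i ^+ 2.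
Definition vgauss n (b : R) (x : 'rV[R]_n) : R := expR (- (b * sqn x)).
(** Same shape as the argument that [iterint] builds, so that [iterintS] holds by computation. *)
Definition vcons n (x : R) (y : 'rV[R]_n) : 'rV[R]_n.+1 := row_mx (\row_(j < 1) x) y.

Lemma vcons0 n x (y : 'rV[R]_n) : vcons x y 0 ord0 = x.
Proof.
rewrite /vcons -[ord0](_ : lshift n (ord0 : 'I_1) = _); last exact: val_inj.
by have := row_mxEl (\row_(j < 1) x) y 0 (ord0 : 'I_1); rewrite mxE.
Qed.

Lemma vconsS n x (y : 'rV[R]_n) i : vcons x y 0 (lift ord0 i) = y 0 i.
Proof.
rewrite /vcons -[lift ord0 i](_ : rshift 1 i = _); last exact: val_inj.
exact: row_mxEr.
Qed.

Lemma vcons_eta n (x : 'rV[R]_n.+1) : vcons (x 0 ord0) (\row_i x 0 (lift ord0 i)) = x.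
Proof.
apply/rowP => i; case: (unliftP ord0 i) => [j|] ->; last exact: vcons0.
by rewrite vconsS mxE.
Qed.

Lemma sqn_vcons n x (y : 'rV[R]_n) : sqn (vcons x y) = x ^+ 2 + sqn y.
Proof.
rewrite /sqn big_ord_recl vcons0; congr +%R.
by apply: eq_bigr => i _; rewrite vconsS.
Qed.

Lemma dotR_vcons n x (y : 'rV[R]_n) (z : 'rV[R]_n.+1) :
  dotR (vcons x y) z = x * z 0 ord0 + dotR y (\row_i z 0 (lift ord0 i)).
Proof.
rewrite /dotR big_ord_recl vcons0; congr +%R.
by apply: eq_bigr => i _; rewrite vconsS mxE.
Qed.

Lemma vgauss_ge0 n b (x : 'rV[R]_n) : 0 <= vgauss b x.
Proof. exact: expR_ge0. Qed.

Lemma vgauss_vcons n b x (y : 'rV[R]_n) : vgauss b (vcons x y) = gauss b x * vgauss b y.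
Proof. by rewrite /vgauss /gauss -expRD sqn_vcons mulrDr opprD. Qed.

Lemma iterintS n (g : 'rV[R]_n.+1 -> R) :
  iterint g = \int[mu]_x iterint (fun y => g (vcons x y)).
Proof. by []. Qed.

Lemma eq_iterint n (f g : 'rV[R]_n -> R) : f =1 g -> iterint f = iterint g.
Proof. by move=> /funext ->. Qed.

(** Coordinatewise convergence of sequences replaces the matrix topology: it passes to slices at
    once, and sequences are what dominated convergence handles. *)
Definition vcvg n (u : nat -> 'rV[R]_n) (l : 'rV[R]_n) :=
  forall i, u k 0 i @[k --> \oo] --> l 0 i.

Definition seq_continuous n (g : 'rV[R]_n -> R) :=
  forall u l, vcvg u l -> g (u k) @[k --> \oo] --> g l.

Lemma seq_continuous_cst n (c : R) : seq_continuous (fun _ : 'rV[R]_n => c).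
Proof. by move=> u l _; exact: cvg_cst. Qed.

Lemma seq_continuous_coord n i : seq_continuous (fun x : 'rV[R]_n => x 0 i).
Proof. by move=> u l; apply. Qed.

Lemma seq_continuousD n (f g : 'rV[R]_n -> R) :
  seq_continuous f -> seq_continuous g -> seq_continuous (fun x => f x + g x).
Proof. by move=> cf cg u l ul; apply: cvgD; [exact: cf|exact: cg]. Qed.

Lemma seq_continuousM n (f g : 'rV[R]_n -> R) :
  seq_continuous f -> seq_continuous g -> seq_continuous (fun x => f x * g x).
Proof. by move=> cf cg u l ul; apply: cvgM; [exact: cf|exact: cg]. Qed.

Lemma seq_continuousX n (f : 'rV[R]_n -> R) k :
  seq_continuous f -> seq_continuous (fun x => f x ^+ k).
Proof.
move=> cf; elim: k => [|k IH]; first exact: seq_continuous_cst.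
by under eq_fun do rewrite exprS; exact: seq_continuousM.
Qed.

Lemma seq_continuous_comp n (h : R -> R) (f : 'rV[R]_n -> R) :
  continuous h -> seq_continuous f -> seq_continuous (fun x => h (f x)).
Proof. by move=> ch cf u l ul; apply: (cvg_comp _ _ (cf u l ul)); exact: ch. Qed.

Lemma seq_continuous_sum n (I : Type) (s : seq I) (f : I -> 'rV[R]_n -> R) :
  (forall i, seq_continuous (f i)) -> seq_continuous (fun x => \sum_(i <- s) f i x).
Proof.
move=> cf; elim: s => [|i s IH].
  by under eq_fun do rewrite big_nil; exact: seq_continuous_cst.
by under eq_fun do rewrite big_cons; exact: seq_continuousD.
Qed.

Lemma seq_continuous_dotR n (z : 'rV[R]_n) : seq_continuous (fun x => dotR x z).
Proof.
rewrite /dotR; apply: seq_continuous_sum => i; apply: seq_continuousM.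
  exact: seq_continuous_coord.
exact: seq_continuous_cst.
Qed.

Lemma seq_continuous_sqnB n (p : 'rV[R]_n) : seq_continuous (fun x => sqn (x - p)).
Proof.
apply: seq_continuous_sum => i; under eq_fun do rewrite !mxE.
apply: seq_continuousX; apply: seq_continuousD; last exact: seq_continuous_cst.
exact: seq_continuous_coord.
Qed.

Lemma seq_continuous_enorm n : seq_continuous (@enorm R n).
Proof.
apply: seq_continuous_comp; first exact: sqrt_continuous.
apply: seq_continuous_sum => i; apply: seq_continuousX; exact: seq_continuous_coord.
Qed.

Lemma seq_continuous_vgaussB n b (p : 'rV[R]_n) :
  seq_continuous (fun x => vgauss b (x - p)).
Proof.
rewrite /vgauss; apply: seq_continuous_comp; first exact: continuous_expR.
apply: (@seq_continuous_comp _ -%R); first exact: oppr_continuous.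
apply: seq_continuousM; first exact: seq_continuous_cst.
exact: seq_continuous_sqnB.
Qed.

Lemma seq_continuous_slice n (g : 'rV[R]_n.+1 -> R) x :
  seq_continuous g -> seq_continuous (fun y => g (vcons x y)).
Proof.
move=> cg u l ul; apply: (cg (fun k => vcons x (u k)) (vcons x l)) => i.
case: (unliftP ord0 i) => [j|] ->.
  by under eq_fun do rewrite vconsS; rewrite vconsS; exact: ul.
by under eq_fun do rewrite vcons0; rewrite vcons0; exact: cvg_cst.
Qed.

Definition gauss_bounded n (C : R) (g : 'rV[R]_n -> R) :=
  forall x, `|g x| <= C * vgauss 8^-1 x.

Lemma gauss_bounded_slice n C (g : 'rV[R]_n.+1 -> R) x :
  gauss_bounded C g -> gauss_bounded (C * gauss 8^-1 x) (fun y => g (vcons x y)).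
Proof. by move=> bg y; rewrite -mulrA -vgauss_vcons. Qed.

Let K := Num.sqrt (pi / 8^-1 : R).

Let pos8 : (0 : R) < 8^-1. Proof. by lra. Qed.

Definition iterint_dominated_cvg n := forall C (F : nat -> 'rV[R]_n -> R) f,
  (forall k, seq_continuous (F k)) -> (forall k, gauss_bounded C (F k)) ->
  seq_continuous f -> (forall x, F k x @[k --> \oo] --> f x) ->
  iterint (F k) @[k --> \oo] --> iterint f.

(** The partial integral is in fact continuous in the remaining variable: tested along sequences,
    this is dominated convergence in dimension [n]. *)
Lemma measurable_slice n C (g : 'rV[R]_n.+1 -> R) : iterint_dominated_cvg n ->
  seq_continuous g -> gauss_bounded C g ->
  measurable_fun setT (fun x => iterint (fun y => g (vcons x y))).
Proof.
move=> dcv cg bg; apply: continuous_measurable_fun => x; apply/(@cvg_nbhsP _ R^o) => u ux.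
apply: (dcv `|C|).
- by move=> k; exact: seq_continuous_slice.
- move=> k y; apply: le_trans (bg _) _.
  rewrite vgauss_vcons mulrA ler_wpM2r ?vgauss_ge0//.
  (* The factor [gauss 8^-1 (u k)] is at most 1; dropping it leaves a bound independent of [k]. *)
  apply: (@le_trans _ _ (`|C| * gauss 8^-1 (u k))).
    by rewrite ler_wpM2r ?gauss_ge0// ler_norm.
  by rewrite ler_piMr// /gauss -expR0 ler_expR oppr_le0 mulr_ge0 ?sqr_ge0// ltW.
- exact: seq_continuous_slice.
- move=> y; apply: (cg (fun k => vcons (u k) y)) => i.
  case: (unliftP ord0 i) => [j|] ->.
    by under eq_fun do rewrite vconsS; rewrite vconsS; exact: cvg_cst.
  by under eq_fun do rewrite vcons0; rewrite vcons0.
Qed.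

(* The two halves go through the induction together: dominated convergence in
   dimension n makes the partial integrals in dimension n + 1 measurable. *)
Let iterint_bound_cvg n :
  (forall C (g : 'rV[R]_n -> R), seq_continuous g -> gauss_bounded C g ->
     `|iterint g| <= C * K ^+ n) /\
  iterint_dominated_cvg n.
Proof.
elim: n => [|n [IHb IHc]].
  split=> [C g _ bg|C F f _ _ _ Ff]; last exact: Ff.
  have := bg 0; rewrite /vgauss /sqn big_ord0 mulr0 oppr0 expR0 expr0 => h.
  exact: h.
have bnd C (g : 'rV[R]_n.+1 -> R) : seq_continuous g -> gauss_bounded C g ->
    forall x, `|iterint (fun y => g (vcons x y))| <= C * K ^+ n * gauss 8^-1 x.
  move=> cg bg x; rewrite mulrAC.
  by apply: IHb; [exact: seq_continuous_slice|exact: gauss_bounded_slice].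
split=> [C g cg bg|C F f cF bF cf Ff]; rewrite iterintS.
  have ig := gauss_dominated_integrable pos8 (measurable_slice IHc cg bg) (bnd _ _ cg bg).
  apply: le_trans (le_normr_Rintegral _ _) _ => //.
  have ig8 : mu.-integrable setT (EFin \o (fun x => gauss 8^-1 x)).
    by have := integrable_gauss 0 pos8; under eq_fun do rewrite subr0.
  apply: (@le_trans _ _ (\int[mu]_x (C * K ^+ n * gauss 8^-1 x))).
    apply: le_Rintegral => //.
    - exact: integrable_norm.
    - by have := integrableZl measurableT (C * K ^+ n) ig8; apply: eq_integrable.
    - by move=> x _; exact: bnd.
  rewrite RintegralZl// exprSr mulrA.
  have := @Rintegral_gauss R 8^-1 0 pos8; under eq_Rintegral do rewrite subr0.
  by move=> ->.
apply: (@Rintegral_dominated_cvg R (C * K ^+ n) 8^-1) => //.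
- by move=> k; exact: measurable_slice (bF k).
- by move=> k x; exact: bnd.
- move=> x; apply: (IHc (C * gauss 8^-1 x)).
  + by move=> k; exact: seq_continuous_slice.
  + by move=> k; exact: gauss_bounded_slice.
  + exact: seq_continuous_slice.
  + by move=> y; exact: Ff.
Qed.

(** The class on which [iterint] is shown to be linear and monotone: it is stable under slicing, and
    the partial integrals of its members are integrable. *)
Definition gauss_good n (g : 'rV[R]_n -> R) :=
  seq_continuous g /\ exists C, gauss_bounded C g.

Lemma gauss_good_slice n (g : 'rV[R]_n.+1 -> R) x :
  gauss_good g -> gauss_good (fun y => g (vcons x y)).
Proof.
move=> [cg [C bg]]; split; first exact: seq_continuous_slice.
by exists (C * gauss 8^-1 x); exact: gauss_bounded_slice.
Qed.

Lemma integrable_slice n (g : 'rV[R]_n.+1 -> R) : gauss_good g ->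
  mu.-integrable setT (EFin \o (fun x => iterint (fun y => g (vcons x y)))).
Proof.
move=> [cg [C bg]]; have [IHb IHc] := iterint_bound_cvg n.
apply: (@gauss_dominated_integrable R (C * K ^+ n) 8^-1) => //.
  exact: measurable_slice bg.
move=> x; rewrite mulrAC.
by apply: IHb; [exact: seq_continuous_slice|exact: gauss_bounded_slice].
Qed.

Lemma gauss_good_bounded n (f g : 'rV[R]_n -> R) :
  seq_continuous f -> gauss_good g -> (forall x, `|f x| <= `|g x|) -> gauss_good f.
Proof.
move=> cf [cg [C bg]] fg; split=> //; exists C => x.
exact: le_trans (fg x) (bg x).
Qed.

Lemma gauss_goodD n (f g : 'rV[R]_n -> R) :
  gauss_good f -> gauss_good g -> gauss_good (fun x => f x + g x).
Proof.
move=> [cf [C bf]] [cg [D bg]]; split; first exact: seq_continuousD.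
exists (C + D) => x; rewrite mulrDl; apply: le_trans (ler_normD _ _) _.
exact: lerD.
Qed.

Lemma gauss_goodZ n c (g : 'rV[R]_n -> R) :
  gauss_good g -> gauss_good (fun x => c * g x).
Proof.
move=> [cg [C bg]]; split.
  by apply: seq_continuousM => //; exact: seq_continuous_cst.
by exists (`|c| * C) => x; rewrite normrM -mulrA ler_wpM2l.
Qed.

Lemma gauss_good0 n : gauss_good (fun _ : 'rV[R]_n => 0).
Proof.
split; first exact: seq_continuous_cst.
by exists 0 => x; rewrite normr0 mul0r.
Qed.

Lemma gauss_good_sum n (I : Type) (s : seq I) (f : I -> 'rV[R]_n -> R) :
  (forall i, gauss_good (f i)) -> gauss_good (fun x => \sum_(i <- s) f i x).
Proof.
move=> gf; elim: s => [|i s IH].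
  by under eq_fun do rewrite big_nil; exact: gauss_good0.
by under eq_fun do rewrite big_cons; exact: gauss_goodD.
Qed.

Lemma iterintZ n c (g : 'rV[R]_n -> R) : gauss_good g ->
  iterint (fun x => c * g x) = c * iterint g.
Proof.
elim: n g => [//|n IH] g gg; rewrite !iterintS -RintegralZl//; last exact: integrable_slice.
by apply: eq_Rintegral => x _; apply: IH; exact: gauss_good_slice.
Qed.

Lemma iterintD n (f g : 'rV[R]_n -> R) : gauss_good f -> gauss_good g ->
  iterint (fun x => f x + g x) = iterint f + iterint g.
Proof.
elim: n f g => [//|n IH] f g gf gg.
rewrite !iterintS -RintegralD//; try exact: integrable_slice.
by apply: eq_Rintegral => x _; apply: IH; exact: gauss_good_slice.
Qed.

Lemma iterint_sum n (I : Type) (s : seq I) (f : I -> 'rV[R]_n -> R) :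
  (forall i, gauss_good (f i)) ->
  iterint (fun x => \sum_(i <- s) f i x) = \sum_(i <- s) iterint (f i).
Proof.
move=> gf; elim: s => [|i s IH].
  (* The integral of zero is computed by homogeneity, zero being written as [0 * 0]. *)
  rewrite big_nil; transitivity (iterint (fun _ : 'rV[R]_n => 0 * 0 : R)).
    by apply: eq_iterint => x; rewrite big_nil mul0r.
  by rewrite iterintZ ?mul0r//; exact: gauss_good0.
rewrite big_cons -IH -iterintD//; last exact: gauss_good_sum.
by apply: eq_iterint => x; rewrite big_cons.
Qed.

Lemma le_iterint n (f g : 'rV[R]_n -> R) : gauss_good f -> gauss_good g ->
  (forall x, f x <= g x) -> iterint f <= iterint g.
Proof.
elim: n f g => [f g _ _ fg|n IH f g gf gg fg]; first exact: fg.
rewrite !iterintS; apply: le_Rintegral => //; try exact: integrable_slice.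
by move=> x _; apply: IH => //; exact: gauss_good_slice.
Qed.

Lemma sqn_ge0 n (x : 'rV[R]_n) : 0 <= sqn x.
Proof. by apply: sumr_ge0 => i _; exact: sqr_ge0. Qed.

Lemma sqn_leBD n (x p : 'rV[R]_n) : sqn x <= 2 * sqn (x - p) + 2 * sqn p.
Proof.
rewrite /sqn !mulr_sumr -big_split/=; apply: ler_sum => i _; rewrite !mxE.
have := sqr_ge0 (x 0 i - p 0 i - p 0 i); nra.
Qed.

(** Dividing [|x|^2 <= 2 |x-p|^2 + 2 |p|^2] by 8 gives [|x|^2/8 <= |x-p|^2/4 + |p|^2/4]: the
    envelope rate [1/8] fits every rate [b >= 1/4], and [exp(|p|^2/4)] is the price of the
    translation. *)
Lemma gauss_good_vgauss n b (p : 'rV[R]_n) : 4^-1 <= b ->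
  gauss_good (fun x => vgauss b (x - p)).
Proof.
move=> b4; split; first exact: seq_continuous_vgaussB.
exists (expR (4^-1 * sqn p)) => x; rewrite ger0_norm ?vgauss_ge0// /vgauss -expRD ler_expR.
have := sqn_leBD x p; have := sqn_ge0 (x - p).
by move: (sqn _) (sqn x) (sqn p) => a c d a0; nra.
Qed.

Lemma iterint_vgauss n b (p : 'rV[R]_n) : 4^-1 <= b ->
  iterint (fun x => vgauss b (x - p)) = Num.sqrt (pi / b) ^+ n.
Proof.
move=> b4; have b0 : 0 < b by apply: lt_le_trans b4; lra.
elim: n p => [|n IH] p.
  by rewrite /= /vgauss /sqn big_ord0 mulr0 oppr0 expR0 expr0.
rewrite iterintS; pose q : 'rV[R]_n := \row_i p 0 (lift ord0 i).
rewrite exprS -{1}(Rintegral_gauss (p 0 ord0) b0) mulrC -RintegralZl//; last first.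
  exact: integrable_gauss.
apply: eq_Rintegral => x _; rewrite -(IH q) mulrC -iterintZ; last exact: gauss_good_vgauss.
apply: eq_iterint => y; rewrite -vgauss_vcons; congr vgauss.
apply/rowP => i; case: (unliftP ord0 i) => [j|] ->.
  by rewrite vconsS [LHS]mxE vconsS !mxE.
by rewrite vcons0 [LHS]mxE vcons0 !mxE.
Qed.

Lemma gauss_good_cos n (q : 'rV[R]_n) theta :
  gauss_good (fun x => vgauss 2^-1 x * cos (dotR x q + theta)).
Proof.
have g0 : gauss_good (fun x : 'rV[R]_n => vgauss 2^-1 x).
  have := @gauss_good_vgauss n 2^-1 0; under eq_fun do rewrite subr0.
  by apply; lra.
apply: (gauss_good_bounded _ g0) => [|x].
  apply: seq_continuousM; first by case: g0.
  apply: seq_continuous_comp; first exact: continuous_cos.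
  apply: seq_continuousD; last exact: seq_continuous_cst.
  exact: seq_continuous_dotR.
by rewrite normrM ler_piMr// ler_norml cos_geN1 cos_le1.
Qed.

(** The free phase [theta] carries the induction: while the inner coordinates are integrated, the
    outer term [x * q 0 ord0] is part of the phase. *)
Lemma iterint_vgauss_cos n (q : 'rV[R]_n) theta :
  iterint (fun x => vgauss 2^-1 x * cos (dotR x q + theta)) =
  Num.sqrt (2 * pi) ^+ n * vgauss 2^-1 q * cos theta.
Proof.
elim: n q theta => [|n IH] q theta.
  by rewrite /= /vgauss /sqn /dotR !big_ord0 mulr0 oppr0 expR0 expr0 !mul1r add0r.
rewrite iterintS; pose q' : 'rV[R]_n := \row_i q 0 (lift ord0 i).
transitivity (\int[mu]_x ((Num.sqrt (2 * pi) ^+ n * vgauss 2^-1 q') *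
    (gauss 2^-1 x * cos (x * q 0 ord0 + theta)))).
  apply: eq_Rintegral => x _.
  rewrite mulrCA -IH -iterintZ; last exact: gauss_good_cos.
  apply: eq_iterint => y; rewrite vgauss_vcons dotR_vcons -mulrA.
  by rewrite addrAC addrC.
rewrite RintegralZl//; last first.
  (* Integrability of the one-variable integrand is the case of dimension one, with a constant row
     as frequency. *)
  have := @integrable_slice 0 _ (gauss_good_cos (const_mx (q 0 ord0) : 'rV[R]_1) theta).
  apply: eq_integrable => // x _ /=; congr EFin.
  by rewrite vgauss_vcons dotR_vcons /vgauss /dotR /sqn !big_ord0 mulr0 oppr0 expR0 mulr1 addr0 mxE.
rewrite Rintegral_gauss_cos exprSr.
by rewrite -[q in RHS]vcons_eta vgauss_vcons; ring.
Qed.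

End iterated_integral.

(** * Schwartz functions *)

Section gauss_trig.
Variable R : realType.

Lemma expr1D_le_expR (c : R) m : 0 < c ->
  exists2 M, 0 < M & forall s, 0 <= s -> (1 + s) ^+ m <= M * expR (c * s).
Proof.
move=> c0; pose d := c / m.+1%:R.
have d0 : 0 < d by rewrite divr_gt0.
exists (d^-1 ^+ m * expR c); first by rewrite mulr_gt0 ?expR_gt0// exprn_gt0// invr_gt0.
move=> s s0.
have h : 1 + s <= d^-1 * expR (d * (1 + s)).
  rewrite mulrC ler_pdivlMr//; apply: le_trans (expR_ge1Dx _).
  by rewrite mulrC ler_wpDl.
apply: (@le_trans _ _ ((d^-1 * expR (d * (1 + s))) ^+ m)).
  by rewrite lerXn2r// nnegrE ?addr_ge0// mulr_ge0 ?expR_ge0// invr_ge0 ltW.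
rewrite exprMn -[leRHS]mulrA; apply: ler_wpM2l.
  by rewrite exprn_ge0// invr_ge0 ltW.
rewrite -expRM_natl -expRD ler_expR.
rewrite (_ : c + c * s = c * (1 + s)); last by ring.
rewrite /d mulrA.
rewrite ler_wpM2r ?addr_ge0// mulrCA ler_piMr ?(ltW c0)//.
by rewrite ler_pdivrMr// mul1r ler_nat.
Qed.

(** A class closed under partial derivatives: the sine from differentiating a cosine is a cosine
    with phase shifted by [pi / 2], and the Gaussian contributes a coordinate factor. *)
Inductive gauss_trig n : ('rV[R]_n -> R) -> Prop :=
| gauss_trig_cos q theta :
    gauss_trig (fun x => vgauss 2^-1 x * cos (dotR x q + theta))
| gauss_trigD f g : gauss_trig f -> gauss_trig g -> gauss_trig (fun x => f x + g x)
| gauss_trigZ c f : gauss_trig f -> gauss_trig (fun x => c * f x)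
| gauss_trigX i f : gauss_trig f -> gauss_trig (fun x => x 0 i * f x).

Lemma gauss_trig_sum n (I : Type) (s : seq I) (f : I -> 'rV[R]_n -> R) :
  (forall i, gauss_trig (f i)) -> gauss_trig (fun x => \sum_(i <- s) f i x).
Proof.
move=> gf; elim: s => [|i s IH].
  under eq_fun do rewrite big_nil.
  rewrite (_ : (fun _ => 0) = (fun x : 'rV[R]_n => 0 * (vgauss 2^-1 x * cos (dotR x 0 + 0)))).
    by apply: gauss_trigZ; exact: gauss_trig_cos.
  by apply/funext => x; rewrite mul0r.
by under eq_fun do rewrite big_cons; exact: gauss_trigD.
Qed.

(** Turns a directional derivative into a one-variable derivative at 0, which [trigger_derive] can
    compute; the two difference quotients are the same function. *)
Lemma is_derive_line n (f : 'rV[R]_n -> R) x v (d : R) :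
  is_derive (0 : R) (1 : R) (fun h : R => f (h *: v + x)) d -> is_derive x v f d.
Proof.
have E : (fun h : R => h^-1 *: ((f \o shift x) (h *: v) - f x)) =
    (fun h : R => h^-1 *: (((fun h : R => f (h *: v + x)) \o shift (0 : R)) (h *: (1 : R)) -
       f ((0 : R) *: v + x))).
  by apply/funext => h /=; rewrite scale0r add0r addr0 -[h%:A]/(h * 1) mulr1.
case=> d1 d2; split.
  by rewrite /derivable E.
by rewrite /derive E.
Qed.

Lemma sqn_line n (x : 'rV[R]_n) i h :
  sqn (h *: unit_vec R i + x) = sqn x + 2 * h * x 0 i + h ^+ 2.
Proof.
rewrite /sqn (bigD1 i)//= [in RHS](bigD1 i)//= !mxE !eqxx mulr1.
under eq_bigr => j ji do rewrite !mxE eqxx/= (negbTE ji) mulr0 add0r.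
by ring.
Qed.

Lemma dotR_line n (x q : 'rV[R]_n) i h :
  dotR (h *: unit_vec R i + x) q = dotR x q + h * q 0 i.
Proof.
rewrite /dotR (bigD1 i)//= [in RHS](bigD1 i)//= !mxE !eqxx mulr1.
under eq_bigr => j ji do rewrite !mxE eqxx/= (negbTE ji) mulr0 add0r.
by ring.
Qed.

Lemma is_derive_coord n (x : 'rV[R]_n) i j :
  is_derive x (unit_vec R j) (fun x : 'rV[R]_n => x 0 i) ((i == j)%:R).
Proof.
apply: is_derive_line; under eq_fun do rewrite !mxE.
by apply: trigger_derive; rewrite eqxx /GRing.scale/=; ring.
Qed.

Lemma is_derive_gauss_trig_cos n (x q : 'rV[R]_n) theta i :
  is_derive x (unit_vec R i) (fun x => vgauss 2^-1 x * cos (dotR x q + theta))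
    (- 1 * (x 0 i * (vgauss 2^-1 x * cos (dotR x q + theta))) +
     q 0 i * (vgauss 2^-1 x * cos (dotR x q + (theta + pi / 2)))).
Proof.
apply: is_derive_line; rewrite /vgauss; under eq_fun do rewrite sqn_line dotR_line.
rewrite addrA cosDpihalf.
apply: trigger_derive; rewrite /GRing.scale/=.
by rewrite expr0n/= !(mul0r, mulr0, addr0); field.
Qed.

Lemma gauss_trig_derive n (f : 'rV[R]_n -> R) i : gauss_trig f ->
  exists2 g, gauss_trig g & forall x, is_derive x (unit_vec R i) f (g x).
Proof.
elim=> [q theta|f1 f2 _ [g1 G1 D1] _ [g2 G2 D2]|c f1 _ [g1 G1 D1]|j f1 F1 [g1 G1 D1]].
- eexists; last by move=> x; exact: is_derive_gauss_trig_cos.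
  apply: gauss_trigD; apply: gauss_trigZ; last exact: gauss_trig_cos.
  by apply: gauss_trigX; exact: gauss_trig_cos.
- exists (fun x => g1 x + g2 x); first exact: gauss_trigD.
  by move=> x; exact: is_deriveD.
- exists (fun x => c * g1 x); first exact: gauss_trigZ.
  by move=> x; exact: is_deriveZ.
- exists (fun x : 'rV[R]_n => x 0 j * g1 x + (j == i)%:R * f1 x).
    by apply: gauss_trigD; [exact: gauss_trigX|exact: gauss_trigZ].
  move=> x; apply: (is_derive_eq (is_deriveM (is_derive_coord x j i) (D1 x))).
  by rewrite /GRing.scale/= [f1 x * _]mulrC.
Qed.

Lemma gauss_trig_iter_partial n (f : 'rV[R]_n -> R) beta : gauss_trig f ->
  gauss_trig (iter_partial beta f).
Proof.
move=> gf; elim: beta => [//|i beta IH] /=.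
have [g gg dg] := gauss_trig_derive i IH.
by rewrite (_ : (fun x => _) = g)//; apply/funext => x; case: (dg x).
Qed.

Lemma coord_le1Dsqn n (x : 'rV[R]_n) i : `|x 0 i| <= 1 + sqn x.
Proof.
have h : x 0 i ^+ 2 <= sqn x.
  by rewrite /sqn (bigD1 i)//= lerDl sumr_ge0// => j _; exact: sqr_ge0.
have : `|x 0 i| <= 1 + `|x 0 i| ^+ 2 by nra.
by move=> /le_trans; apply; rewrite lerD2l real_normK// num_real.
Qed.

Lemma gauss_trig_bound n (f : 'rV[R]_n -> R) : gauss_trig f ->
  exists C k, 0 <= C /\ forall x, `|f x| <= C * (1 + sqn x) ^+ k * vgauss 2^-1 x.
Proof.
elim=> [q theta|f1 f2 _ [C [k [C0 h1]]] _ [D [l [D0 h2]]]|c f1 _ [C [k [C0 h1]]]|j f1 _ [C [k [C0 h1]]]].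
- exists 1, 0%N; split=> // x; rewrite expr0 !mul1r normrM ger0_norm ?vgauss_ge0//.
  by rewrite ler_piMr ?vgauss_ge0// ler_norml cos_geN1 cos_le1.
- exists (C + D), (k + l)%N; split; first exact: addr_ge0.
  move=> x; apply: le_trans (ler_normD _ _) _; rewrite !mulrDl.
  have s1 : 1 <= 1 + sqn x by rewrite lerDl sqn_ge0.
  apply: lerD; [apply: le_trans (h1 x) _|apply: le_trans (h2 x) _].
    by rewrite ler_wpM2r ?vgauss_ge0// ler_wpM2l// ler_weXn2l// leq_addr.
  by rewrite ler_wpM2r ?vgauss_ge0// ler_wpM2l// ler_weXn2l// leq_addl.
- exists (`|c| * C), k; split; first exact: mulr_ge0.
  by move=> x; rewrite normrM -!mulrA ler_wpM2l// mulrA.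
- exists C, k.+1; split=> // x; rewrite normrM exprS.
  apply: (@le_trans _ _ ((1 + sqn x) * (C * (1 + sqn x) ^+ k * vgauss 2^-1 x))).
    by apply: ler_pM => //; exact: coord_le1Dsqn.
  by rewrite !mulrA [C * _]mulrC.
Qed.

Lemma gauss_trig_schwartzR n (f : 'rV[R]_n -> R) : gauss_trig f -> schwartzR f.
Proof.
move=> gf beta; have gb := gauss_trig_iter_partial beta gf; split=> [x i|k].
  by have [g _ dg] := gauss_trig_derive i gb; case: (dg x).
have [C [l [C0 h]]] := gauss_trig_bound gb.
have [M M0 hM] := @expr1D_le_expR 2^-1 (k + l) ltac:(lra).
exists (C * M) => x.
have -> : enorm x ^+ 2 = sqn x by rewrite /enorm sqr_sqrtr ?sqn_ge0.
apply: (@le_trans _ _ ((1 + sqn x) ^+ k * (C * (1 + sqn x) ^+ l * vgauss 2^-1 x))).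
  by rewrite ler_wpM2l// exprn_ge0// addr_ge0// sqn_ge0.
rewrite -!mulrA mulrCA ler_wpM2l// mulrA -exprD.
by rewrite /vgauss expRN ler_pdivrMr ?expR_gt0// hM// sqn_ge0.
Qed.

End gauss_trig.

(** * Euclidean norm *)

Section euclidean.
Variable R : realType.

Lemma enorm_ge0 n (x : 'rV[R]_n) : 0 <= enorm x.
Proof. exact: sqrtr_ge0. Qed.

Lemma sqr_enorm n (x : 'rV[R]_n) : enorm x ^+ 2 = sqn x.
Proof. by rewrite /enorm sqr_sqrtr// sqn_ge0. Qed.

Lemma sqn_scaleD n (x y : 'rV[R]_n) (s t : R) :
  sqn (s *: x + t *: y) = s ^+ 2 * sqn x + 2 * (s * t) * dotR x y + t ^+ 2 * sqn y.
Proof.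
rewrite /sqn /dotR !mulr_sumr -!big_split/=; apply: eq_bigr => i _.
by rewrite !mxE; ring.
Qed.

(** Cauchy-Schwarz from the square of [s b x - a y] with [a = |x| + e], [b = |y| + e] and [s] a
    sign. The shift [e] makes [a b] positive, so that zero vectors require no separate case; then
    [e] is sent to 0. *)
Lemma dotR_le_enorm n (x y : 'rV[R]_n) : `|dotR x y| <= enorm x * enorm y.
Proof.
have h (s : R) : `|s| = 1 -> s * dotR x y <= enorm x * enorm y.
  move=> s1; have ss : s ^+ 2 = 1 by rewrite -(real_normK (num_real s)) s1 expr1n.
  have sgen (e : R) : 0 < e -> s * dotR x y <= (enorm x + e) * (enorm y + e).
    move=> e0.
    pose a := enorm x + e; pose b := enorm y + e.
    have a0 : 0 < a by rewrite ltr_wpDl ?enorm_ge0.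
    have b0 : 0 < b by rewrite ltr_wpDl ?enorm_ge0.
    have := sqn_ge0 ((s * b) *: x + (- a) *: y).
    rewrite sqn_scaleD -!sqr_enorm exprMn ss sqrrN mul1r.
    have ha : enorm x ^+ 2 <= a ^+ 2.
      by rewrite lerXn2r ?nnegrE ?enorm_ge0 ?(ltW a0)// /a lerDl ltW.
    have hb : enorm y ^+ 2 <= b ^+ 2.
      by rewrite lerXn2r ?nnegrE ?enorm_ge0 ?(ltW b0)// /b lerDl ltW.
    have h1 : b ^+ 2 * enorm x ^+ 2 <= b ^+ 2 * a ^+ 2 by rewrite ler_wpM2l ?sqr_ge0.
    have h2 : a ^+ 2 * enorm y ^+ 2 <= a ^+ 2 * b ^+ 2 by rewrite ler_wpM2l ?sqr_ge0.
    move=> h3; rewrite -/a -/b.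
    have ab : 0 < a * b by rewrite mulr_gt0.
    rewrite -(ler_pM2l ab); move: (enorm x) (enorm y) (dotR x y) ha hb h1 h2 h3 => u v w.
    move=> _ _; nra.
  apply/ler_addgt0Pr => e e0.
  pose M := enorm x + enorm y + 1.
  have M0 : 0 < M by rewrite ltr_wpDl ?addr_ge0 ?enorm_ge0.
  (* [d <= 1] gives [d^2 <= d], so the total excess [d (|x| + |y|) + d^2] is at most [d M <= e]. *)
  pose d := Num.min 1 (e / M).
  have d0 : 0 < d by rewrite lt_min ltr01 divr_gt0.
  have d1 : d <= 1 by rewrite ge_min lexx.
  have dM : d * M <= e by rewrite -ler_pdivlMr// ge_min lexx orbT.
  apply: le_trans (sgen d d0) _.
  have : d * d <= d by rewrite ler_piMr// ltW.
  by move: dM; rewrite /M; nra.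
rewrite ler_norml; apply/andP; split; last by have := h 1; rewrite normr1 mul1r; apply.
by rewrite lerNl -mulN1r; apply: h; rewrite normrN1.
Qed.

Lemma enormD n (x y : 'rV[R]_n) : enorm (x + y) <= enorm x + enorm y.
Proof.
rewrite -(@ler_pXn2r _ 2)// ?nnegrE ?addr_ge0 ?enorm_ge0//.
rewrite sqr_enorm -[x]scale1r -[y]scale1r sqn_scaleD !scale1r -!sqr_enorm.
have := dotR_le_enorm x y; rewrite ler_norml => /andP[_].
by move: (dotR x y) (enorm x) (enorm y) => w u v; nra.
Qed.

Lemma enormN n (x : 'rV[R]_n) : enorm (- x) = enorm x.
Proof. by rewrite /enorm; congr Num.sqrt; apply: eq_bigr => i _; rewrite mxE sqrrN. Qed.

Lemma ler_dist_enorm n (x y : 'rV[R]_n) : `|enorm x - enorm y| <= enorm (x - y).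
Proof.
rewrite ler_norml; apply/andP; split.
  rewrite lerNl opprB lerBlDr -[X in X + _]enormN opprB.
  by rewrite -{1}[y](subrK x); exact: enormD.
by rewrite lerBlDr -{1}[x](subrK y); exact: enormD.
Qed.

Lemma dotRBr n (x y z : 'rV[R]_n) : dotR x (y - z) = dotR x y - dotR x z.
Proof.
rewrite /dotR -sumrB; apply: eq_bigr => i _; rewrite !mxE; ring.
Qed.

Lemma dotRZl n (x y : 'rV[R]_n) t : dotR (t *: x) y = t * dotR x y.
Proof. by rewrite /dotR mulr_sumr; apply: eq_bigr => i _; rewrite mxE mulrA. Qed.

Lemma vgaussN n b (x : 'rV[R]_n) : vgauss b (- x) = vgauss b x.
Proof. by rewrite /vgauss -!sqr_enorm enormN. Qed.

Lemma sqr_sin_le (y : R) : sin y ^+ 2 <= y ^+ 2.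
Proof.
have h (z : R) : 0 <= z -> sin z ^+ 2 <= z ^+ 2.
  move=> z0.
  have [c _] := @MVT_segment R sin cos 0 z z0
    (fun x _ => is_derive_sin x) (continuous_subspaceT (@continuous_sin R)).
  rewrite sin0 !subr0 => ->; by rewrite exprMn ler_piMl ?sqr_ge0.
have [/h//|/ltW y0] := leP 0 y.
by rewrite -[leLHS]sqrrN -sinN -[leRHS]sqrrN h// oppr_ge0.
Qed.

Lemma cos_ge (y : R) : 1 - y ^+ 2 / 2 <= cos y.
Proof.
have -> : cos y = 1 - 2 * sin (y / 2) ^+ 2.
  have -> : cos y = cos (y / 2 + y / 2) by congr cos; field.
  by rewrite cosD -!expr2 cos2sin2; ring.
have := sqr_sin_le (y / 2); rewrite expr_div_n; nra.
Qed.

End euclidean.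

(** * Wave packets *)

Section packets.
Variable R : realType.
Local Notation mu := (@lebesgue_measure R).
Variables (n : nat) (I : finType) (p : I -> 'rV[R]_n) (a : I -> R).
Hypothesis a_ge0 : forall i, 0 <= a i.

(* Both parts are written with a phase-shifted cosine, the sine being
   [cos (_ - pi / 2)], so that one Fourier formula covers them. *)
Definition packet (x : 'rV[R]_n) : R[i] :=
  Complex (\sum_i a i * (vgauss 2^-1 x * cos (dotR x (p i) + 0)))
          (\sum_i a i * (vgauss 2^-1 x * cos (dotR x (p i) + - (pi / 2)))).

Definition packet_hat (xi : 'rV[R]_n) : R := \sum_i a i * vgauss 2^-1 (xi - p i).

Lemma schwartz_packet : schwartz packet.
Proof.
split; apply: gauss_trig_schwartzR; apply: gauss_trig_sum => i;
  apply: gauss_trigZ; exact: gauss_trig_cos.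
Qed.

(** The Gaussian is its own transform and each modulation moves it to [p i]. The imaginary part is
    the same integral with phase [- (pi / 2)], hence carries the factor [cos (- (pi / 2)) = 0]. *)
Lemma fourier_packet xi :
  fourier packet xi = Complex (Num.sqrt (2 * pi) ^+ n * packet_hat xi) 0.
Proof.
have H theta : iterint (fun x : 'rV[R]_n =>
    \sum_i a i * (vgauss 2^-1 x * cos (dotR x (p i - xi) + theta))) =
    cos theta * (Num.sqrt (2 * pi) ^+ n * packet_hat xi).
  rewrite iterint_sum => [|i]; last by apply: gauss_goodZ; exact: gauss_good_cos.
  rewrite /packet_hat !mulr_sumr; apply: eq_bigr => i _.
  rewrite iterintZ; last exact: gauss_good_cos.
  by rewrite iterint_vgauss_cos -[p i - xi]opprB vgaussN; ring.
rewrite /fourier /cint; congr Complex.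
  have := H 0; rewrite cos0 mul1r => <-; apply: eq_iterint => x /=.
  rewrite cosN sinN mulNr opprK !mulr_sumr -big_split/=; apply: eq_bigr => i _.
  rewrite cosBpihalf !addr0 dotRBr cosB; ring.
have := H (- (pi / 2)); rewrite cosN cos_pihalf mul0r => <-; apply: eq_iterint => x /=.
rewrite cosN sinN mulNr !mulr_sumr -sumrB; apply: eq_bigr => i _.
rewrite !cosBpihalf !addr0 dotRBr sinB; ring.
Qed.

Lemma gauss_good_packet_hat : gauss_good packet_hat.
Proof.
apply: gauss_good_sum => i; apply: gauss_goodZ; apply: gauss_good_vgauss; lra.
Qed.

Variable V : 'rV[R]_n.
Hypothesis cone : forall i, enorm (p i) + dotR V (p i) = 0.

(* The phase vanishes at the centers of the packets. *)
Lemma phase_le xi i :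
  `|dotR V xi + enorm xi| <= (1 + enorm V) * enorm (xi - p i).
Proof.
have -> : dotR V xi + enorm xi = (enorm xi - enorm (p i)) + dotR V (xi - p i).
  by rewrite dotRBr; have := cone i; lra.
apply: le_trans (ler_normD _ _) _; rewrite mulrDl mul1r lerD//.
  exact: ler_dist_enorm.
exact: dotR_le_enorm.
Qed.

Lemma sqn_vgauss_le (x : 'rV[R]_n) : sqn x * vgauss 2^-1 x <= 4 * vgauss 4^-1 x.
Proof.
have -> : vgauss 2^-1 x = vgauss 4^-1 x * vgauss 4^-1 x.
  by rewrite /vgauss -expRD; congr expR; field.
rewrite mulrA ler_wpM2r ?vgauss_ge0// /vgauss expRN ler_pdivrMr ?expR_gt0//.
have := expR_ge1Dx (4^-1 * sqn x); move: (expR _) => e; lra.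
Qed.

(** By [cos y >= 1 - y^2/2] and [phase_le], each packet loses at most [2 t^2 (1 + |V|)^2] times a
    Gaussian of rate [1/4]. The hypothesis says that this loss is at most half of the main mass; it
    involves neither the centers nor the amplitudes, so one time interval serves all families. *)
Lemma wave_packet_ge t :
  4 * t ^+ 2 * (1 + enorm V) ^+ 2 * Num.sqrt (pi / 4^-1) ^+ n <= Num.sqrt (pi / 2^-1) ^+ n ->
  (\sum_i a i) / 2 <= complex.Re (wave t packet (t *: V)).
Proof.
move=> ht; set A := Num.sqrt (pi / 2^-1 : R).
have A2 : Num.sqrt (2 * pi) = A by rewrite /A invrK mulrC.
have q4 : (4^-1 : R) <= 2^-1 by lra.
rewrite /wave /= mul0r subr0.
have -> : iterint (fun xi : 'rV[R]_n => complex.Re (expi (dotR (t *: V) xi) *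
    expi (t * enorm xi) * fourier packet xi)) =
    iterint (fun xi : 'rV[R]_n => A ^+ n * (cos (t * (dotR V xi + enorm xi)) * packet_hat xi)).
  apply: eq_iterint => xi; rewrite fourier_packet /= A2 dotRZl mulrDr cosD; ring.
have g1 : gauss_good (fun xi => cos (t * (dotR V xi + enorm xi)) * packet_hat xi).
  apply: gauss_good_bounded gauss_good_packet_hat _.
    apply: seq_continuousM; last by case: gauss_good_packet_hat.
    apply: seq_continuous_comp; first exact: continuous_cos.
    apply: seq_continuousM; first exact: seq_continuous_cst.
    apply: seq_continuousD; last exact: seq_continuous_enorm.
    apply: seq_continuous_sum => i; apply: seq_continuousM.
      exact: seq_continuous_cst.
    exact: seq_continuous_coord.
  by move=> x; rewrite normrM ler_piMl// cos_max.
rewrite iterintZ//.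
pose L2 := (1 + enorm V) ^+ 2.
pose low xi := \sum_i a i * (vgauss 2^-1 (xi - p i) + (- (2 * t ^+ 2 * L2)) * vgauss 4^-1 (xi - p i)).
have glow' i : gauss_good (fun xi => vgauss 2^-1 (xi - p i) + (- (2 * t ^+ 2 * L2)) * vgauss 4^-1 (xi - p i)).
  by apply: gauss_goodD; [|apply: gauss_goodZ]; apply: gauss_good_vgauss.
have glow : gauss_good low by apply: gauss_good_sum => i; exact: gauss_goodZ.
have lowE : iterint low = (\sum_i a i) * (A ^+ n - 2 * t ^+ 2 * L2 * Num.sqrt (pi / 4^-1) ^+ n).
  rewrite iterint_sum => [|i]; last exact: gauss_goodZ.
  rewrite mulr_suml; apply: eq_bigr => i _.
  rewrite iterintZ// iterintD ?iterintZ ?iterint_vgauss ?mulNr//; try exact: gauss_good_vgauss.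
  by apply: gauss_goodZ; exact: gauss_good_vgauss.
have le1 : iterint low <= iterint (fun xi => cos (t * (dotR V xi + enorm xi)) * packet_hat xi).
  apply: le_iterint => // xi; rewrite /low /packet_hat mulr_sumr; apply: ler_sum => i _.
  rewrite [leRHS]mulrCA; apply: ler_wpM2l => //.
  have c1 := cos_ge (t * (dotR V xi + enorm xi)).
  have c2 := phase_le xi i.
  have c3 : (dotR V xi + enorm xi) ^+ 2 <= L2 * sqn (xi - p i).
    rewrite -(real_normK (num_real (_ + _))) -sqr_enorm /L2 -exprMn lerXn2r// nnegrE.
    by rewrite mulr_ge0 ?addr_ge0 ?enorm_ge0.
  have c4 := sqn_vgauss_le (xi - p i).
  have c5 := vgauss_ge0 2^-1 (xi - p i).
  apply: le_trans (ler_wpM2r c5 c1).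
  rewrite mulrBl mul1r mulNr lerD2l lerN2 exprMn.
  apply: (@le_trans _ _ (t ^+ 2 * (L2 * sqn (xi - p i)) / 2 * vgauss 2^-1 (xi - p i))).
    by rewrite ler_wpM2r// ler_wpM2r ?invr_ge0// ler_wpM2l ?sqr_ge0.
  have : t ^+ 2 * L2 / 2 * (sqn (xi - p i) * vgauss 2^-1 (xi - p i)) <=
         t ^+ 2 * L2 / 2 * (4 * vgauss 4^-1 (xi - p i)).
    by rewrite ler_wpM2l// divr_ge0// mulr_ge0 ?sqr_ge0.
  lra.
have S0 : 0 <= \sum_i a i by apply: sumr_ge0.
have le2 : (\sum_i a i) * (A ^+ n / 2) <= iterint low.
  by rewrite lowE ler_wpM2l//; move: ht; rewrite -/L2 -/A; lra.
(* One [A ^+ n] comes from the Fourier transform and one from the mass of the Gaussian; together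
   they cancel the prefactor of [wave]. *)
have AA : (2 * pi) ^+ n = A ^+ n * A ^+ n.
  rewrite -exprMn -expr2 sqr_sqrtr; first by rewrite invrK mulrC.
  by rewrite divr_ge0 ?pi_ge0.
have A0 : 0 < A ^+ n.
  by rewrite exprn_gt0// sqrtr_gt0 divr_gt0 ?pi_gt0.
rewrite AA; apply: (@le_trans _ _ ((A ^+ n * A ^+ n)^-1 * (A ^+ n * iterint low))); last first.
  by rewrite ler_wpM2l ?invr_ge0 ?mulr_ge0 ?(ltW A0)// ler_wpM2l// ltW.
apply: (@le_trans _ _ ((A ^+ n * A ^+ n)^-1 * (A ^+ n * ((\sum_i a i) * (A ^+ n / 2))))); last first.
  by rewrite ler_wpM2l ?invr_ge0 ?mulr_ge0 ?(ltW A0)// ler_wpM2l// ltW.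
move: (A ^+ n) A0 => B B0; rewrite le_eqVlt; apply/orP; left; apply/eqP; field.
by rewrite gt_eqF.
Qed.

End packets.

(** Weighted Cauchy-Schwarz, by [a_i a_j <= (a_i^2 + a_j^2) / 2] in the double sum. With
    [\sum_i g i] bounded it plays the role of almost orthogonality. *)
Lemma sqr_sum_le (R : realType) (I : finType) (a g : I -> R) :
  (forall i, 0 <= g i) ->
  (\sum_i a i * g i) ^+ 2 <= (\sum_i a i ^+ 2 * g i) * \sum_i g i.
Proof.
move=> g0.
have E : (\sum_i a i ^+ 2 * g i) * (\sum_i g i) =
    \sum_i \sum_j (a i ^+ 2 + a j ^+ 2) / 2 * (g i * g j).
  have -> : \sum_i \sum_j (a i ^+ 2 + a j ^+ 2) / 2 * (g i * g j) =
      \sum_i \sum_j (a i ^+ 2 * g i * g j) / 2 + \sum_i \sum_j (a j ^+ 2 * g j * g i) / 2.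
    rewrite -big_split; apply: eq_bigr => i _; rewrite -big_split; apply: eq_bigr => j _ /=.
    by field.
  rewrite [X in _ = _ + X]exchange_big/= -big_split mulr_suml.
  apply: eq_bigr => i _; rewrite mulr_sumr -big_split; apply: eq_bigr => j _ /=.
  by field.
rewrite E expr2 mulr_suml; apply: ler_sum => i _; rewrite mulr_sumr; apply: ler_sum => j _.
rewrite mulrACA; apply: ler_wpM2r; first by rewrite mulr_ge0.
by have := sqr_ge0 (a i - a j); nra.
Qed.

(** * Upper bound for the Sobolev norm of a packet *)

Section packet_norm.
Variables (R : realType) (m : nat).

(** Since [|q| >= 1], [|xi| <= |q| (1 + |xi - q|)]: the weight is replaced by its value at the
    center, and half of the Gaussian absorbs the rest. *)
Lemma enorm_vgauss_le : exists2 M : R, 0 < M &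
  forall (q xi : 'rV[R]_m.+1), 1 <= enorm q ->
  enorm xi ^+ m * vgauss 2^-1 (xi - q) <= M * enorm q ^+ m * vgauss 4^-1 (xi - q).
Proof.
have [M M0 hM] := @expr1D_le_expR R 4^-1 m ltac:(lra).
exists (2 ^+ m * M); first by rewrite mulr_gt0// exprn_gt0.
move=> q xi q1; set r := enorm (xi - q); have r0 : 0 <= r := enorm_ge0 _.
have rs : r ^+ 2 = sqn (xi - q) by exact: sqr_enorm.
have h1 : enorm xi <= enorm q * (2 * (1 + r ^+ 2)).
  have : enorm xi <= enorm q + r by rewrite addrC -{1}[xi](subrK q) enormD.
  move=> /le_trans; apply; have q0 := enorm_ge0 q.
  apply: (@le_trans _ _ (enorm q * (1 + r))); first by rewrite mulrDr mulr1 lerD2l ler_peMl.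
  by apply: ler_wpM2l => //; nra.
have h2 : enorm xi ^+ m <= enorm q ^+ m * (2 ^+ m * (1 + r ^+ 2) ^+ m).
  rewrite -!exprMn lerXn2r// ?nnegrE ?enorm_ge0// mulr_ge0 ?enorm_ge0// mulr_ge0//.
  by rewrite addr_ge0// sqr_ge0.
have -> : vgauss 2^-1 (xi - q) = vgauss 4^-1 (xi - q) * vgauss 4^-1 (xi - q).
  by rewrite /vgauss -expRD; congr expR; field.
rewrite mulrA; apply: ler_wpM2r; first exact: vgauss_ge0.
rewrite {1}/vgauss expRN ler_pdivrMr ?expR_gt0//; apply: le_trans h2 _.
rewrite [leRHS](_ : _ = enorm q ^+ m * (2 ^+ m * (M * expR (4^-1 * sqn (xi - q))))); last by ring.
rewrite ler_wpM2l ?exprn_ge0 ?enorm_ge0// ler_wpM2l ?exprn_ge0// rs.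
exact/hM/sqn_ge0.
Qed.

Variable kappa : R.

Lemma Hdot_packet_le : exists2 D : R, 0 < D &
  forall (I : finType) (p : I -> 'rV[R]_m.+1) (a := fun i => (enorm (p i) ^+ m)^-1),
  (forall i, 1 <= enorm (p i)) ->
  (forall xi, \sum_i vgauss 2^-1 (xi - p i) <= kappa) ->
  Hdot_norm ((m.+1%:R - 1) / 2) (packet p a) <= Num.sqrt (D * \sum_i a i).
Proof.
have [M M0 hM] := enorm_vgauss_le.
pose A := Num.sqrt (2 * pi) ^+ m.+1 : R.
pose B := Num.sqrt (pi / 4^-1) ^+ m.+1 : R.
have B0 : 0 < B by rewrite exprn_gt0// sqrtr_gt0 divr_gt0 ?pi_gt0.
have A0 : 0 < A by rewrite exprn_gt0// sqrtr_gt0 mulr_gt0 ?pi_gt0.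
(* The factors are the Fourier constant, the overlap of the packets, the change of weight and the
   mass of the wider Gaussian; none depends on the family. *)
exists (A ^+ 2 * (`|kappa| + 1) * M * B).
  by rewrite !mulr_gt0// ?exprn_gt0// ltr_wpDl.
move=> I p a p1 pk; rewrite /Hdot_norm; apply: ler_wsqrtr.
have a0 i : 0 <= a i by rewrite invr_ge0 exprn_ge0// enorm_ge0.
have ap i : a i ^+ 2 * enorm (p i) ^+ m = a i.
  rewrite expr2 -mulrA mulVf ?mulr1// gt_eqF// exprn_gt0//.
  by apply: lt_le_trans (p1 i).
pose f (xi : 'rV[R]_m.+1) := A ^+ 2 * (enorm xi ^+ m * packet_hat p a xi ^+ 2).
have -> : (fun xi : 'rV[R]_m.+1 =>
    (enorm xi `^ ((m.+1%:R - 1) / 2) * cmod (fourier (packet p a) xi)) ^+ 2) = f.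
  apply/funext => xi; rewrite /f fourier_packet /cmod /= expr0n/= addr0 sqrtr_sqr exprMn.
  rewrite real_normK ?num_real// exprMn -/A.
  have -> : (enorm xi `^ ((m.+1%:R - 1) / 2)) ^+ 2 = enorm xi ^+ m.
    rewrite -powR_mulrn ?powR_ge0// -powRrM divfK ?pnatr_eq0//.
    by rewrite -natr1 addrK powR_mulrn// enorm_ge0.
  by ring.
pose g (xi : 'rV[R]_m.+1) := \sum_i (A ^+ 2 * (`|kappa| + 1) * M * a i) * vgauss 4^-1 (xi - p i).
have gi i : gauss_good (fun xi => vgauss 4^-1 (xi - p i)) by exact: gauss_good_vgauss.
have gg : gauss_good g by apply: gauss_good_sum => i; exact: gauss_goodZ.
have f0 xi : 0 <= f xi.
  by rewrite /f mulr_ge0 ?sqr_ge0// mulr_ge0 ?sqr_ge0// exprn_ge0 ?enorm_ge0.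
have fg xi : f xi <= g xi.
  rewrite /g /f.
  rewrite [leRHS](_ : _ = A ^+ 2 *
      ((`|kappa| + 1) * \sum_i M * a i * vgauss 4^-1 (xi - p i))); last first.
    by rewrite !mulr_sumr; apply: eq_bigr => i _; ring.
  apply: ler_wpM2l; first exact: sqr_ge0.
  have k0 : \sum_i vgauss 2^-1 (xi - p i) <= `|kappa| + 1.
    by apply: le_trans (pk xi) _; apply: le_trans (ler_norm _) _; rewrite lerDl.
  have h1 : packet_hat p a xi ^+ 2 <=
      (\sum_i a i ^+ 2 * vgauss 2^-1 (xi - p i)) * (`|kappa| + 1).
    apply: le_trans (sqr_sum_le _ _) _; first by move=> i; exact: vgauss_ge0.
    apply: ler_wpM2l => //; apply: sumr_ge0 => i _.
    by rewrite mulr_ge0 ?sqr_ge0 ?vgauss_ge0.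
  apply: le_trans (ler_wpM2l _ h1) _; first by rewrite exprn_ge0 ?enorm_ge0.
  rewrite mulrA mulrC; apply: ler_wpM2l; first exact: addr_ge0.
  rewrite mulr_sumr; apply: ler_sum => i _; rewrite mulrCA.
  apply: le_trans (ler_wpM2l (sqr_ge0 _) (hM (p i) xi (p1 i))) _.
  by rewrite -{2}(ap i) le_eqVlt; apply/orP; left; apply/eqP; ring.
have gf : gauss_good f.
  apply: (gauss_good_bounded _ gg) => [|xi]; last first.
    by rewrite !ger0_norm//; exact: le_trans (fg xi).
  apply: seq_continuousM; first exact: seq_continuous_cst.
  apply: seq_continuousM; apply: seq_continuousX; first exact: seq_continuous_enorm.
  by have [] := gauss_good_packet_hat p a.
apply: le_trans (le_iterint gf gg fg) _.
rewrite /g iterint_sum => [|i]; last exact: gauss_goodZ.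
under eq_bigr do rewrite iterintZ// iterint_vgauss// -/B.
by rewrite -mulr_suml -mulr_sumr le_eqVlt; apply/orP; left; apply/eqP; ring.
Qed.

End packet_norm.

(** Every simple function below [f] is below [g], which compares the two defining suprema directly.
    It is applied to the supremum over [x] in [L2Linf_norm], about whose measurability in [t]
    nothing is established. *)
Lemma le_ge0_integralT d (T : measurableType d) (R : realType)
    (mu : {measure set T -> \bar R}) (f g : T -> \bar R) :
  (forall x, 0 <= f x)%E -> (forall x, f x <= g x)%E ->
  (\int[mu]_x f x <= \int[mu]_x g x)%E.
Proof.
move=> f0 fg; rewrite !ge0_integralTE//; last by move=> x; exact: le_trans (fg x).
apply: le_ereal_sup => _ [h hf <-]; exists h => // x.
exact: le_trans (hf x) (fg x).
Qed.

Lemma L2Linf_norm_ge (R : realType) n (F : R -> 'rV[R]_n -> R[i]) (X : R -> 'rV[R]_n)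
    (c d : R) : 0 <= c -> 0 < d ->
  (forall t, `|t| <= d -> c <= complex.Re (F t (X t))) ->
  ((c * Num.sqrt (2 * d))%:E <= L2Linf_norm F)%E.
Proof.
move=> c0 d0 hF; rewrite /L2Linf_norm.
pose I : set R := `[- d, d].
pose g (t : R) : \bar R := ((fun=> (c ^+ 2)%:E) \_ I) t.
have -> : (c * Num.sqrt (2 * d))%:E = sqrte (\int[@lebesgue_measure R]_t g t)%E.
  rewrite /g -integral_mkcond integral_cst//; last exact: measurable_itv.
  have muI : @lebesgue_measure R I = (2 * d)%:E.
    rewrite /I lebesgue_measure_itv/= lte_fin ifT; last by rewrite -subr_gt0; lra.
    by rewrite -EFinB opprK; congr EFin; ring.
  by rewrite [X in (_ * X)%E]muI -EFinM /= [in RHS]sqrtrM ?sqr_ge0// sqrtr_sqr ger0_norm.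
have g0 t : (0 <= g t)%E by rewrite /g /patch; case: ifP => // _; rewrite lee_fin sqr_ge0.
rewrite lee_sqrt; last first.
  apply: integral_ge0 => t _; rewrite -[X in (0 <= X)%E]mul1e; apply: mule_ge0 => //.
  exact: sqre_ge0.
apply: le_ge0_integralT => // t; rewrite /g /patch; case: ifPn => [|_]; last exact: sqre_ge0.
rewrite inE /I/= in_itv/= -ler_norml => td.
rewrite EFin_expe lee_sqr ?lee_fin//; last first.
  apply: (@le_trans _ _ (cmod (F t (X t)))%:E); first by rewrite lee_fin sqrtr_ge0.
  by apply: ereal_sup_ubound; exists (X t).
apply: (@le_trans _ _ (cmod (F t (X t)))%:E); last by apply: ereal_sup_ubound; exists (X t).
rewrite lee_fin; apply: le_trans (hF t td) _; apply: le_trans (ler_norm _) _.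
by rewrite -sqrtr_sqr /cmod ler_wsqrtr// lerDl sqr_ge0.
Qed.

(** * Lattice points on the cone *)

Section lattice.
Variable R : realType.

(* Telescoping against the bounded increasing function z / (1 + |z|). *)
Lemma sum_gauss_le (y : R) M : \sum_(j < M) gauss 2^-1 (y - j%:R) <= 12.
Proof.
(* The factor 6 comes from [(1 + a) (2 + a) <= 6 (1 + a^2/2)]; as [phi] takes values in [[-6, 6]],
   the telescoped sum is at most 12. *)
pose phi (z : R) := 6 * (z / (1 + `|z|)).
have n0 (z : R) : 0 < 1 + `|z| by rewrite ltr_pwDl.
have step (z : R) : gauss 2^-1 z <= phi (z + 1) - phi z.
  have g1 : gauss 2^-1 z <= 6 * ((1 + `|z|) * (2 + `|z|))^-1.
    have a0 := normr_ge0 z.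
    rewrite /gauss expRN ler_pdivlMr ?mulr_gt0 ?ltr_pwDl//.
    rewrite mulrC ler_pdivrMr ?expR_gt0//.
    have := expR_ge1Dx (2^-1 * z ^+ 2); rewrite -(real_normK (num_real z)).
    by move: (`|z|) a0 => a a0; nra.
  apply: le_trans g1 _; rewrite /phi -mulrBr ler_pM2l//.
  have [z0|z0] := leP 0 z.
    rewrite !ger0_norm ?addr_ge0//.
    rewrite le_eqVlt; apply/orP; left; apply/eqP; field.
    by apply/andP; split; apply: lt0r_neq0; lra.
  rewrite (ltr0_norm z0).
  (* When [z < 0 <= z + 1], both denominators are at most 2, so the increment of [z / (1 + |z|)] is
     at least [1/2]. *)
  have [z1|z1] := leP 0 (z + 1).
    rewrite ger0_norm//.
    have h1 : (z + 1) / 2 <= (z + 1) / (1 + (z + 1)).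
      by rewrite ler_wpM2l// lef_pV2 ?posrE; lra.
    have h2 : - z / 2 <= - z / (1 - z).
      by rewrite ler_wpM2l ?lef_pV2 ?posrE; lra.
    have h3 : ((1 - z) * (2 - z))^-1 <= 2^-1.
      by rewrite lef_pV2 ?posrE; nra.
    by rewrite mulNr in h2; lra.
  rewrite (ltr0_norm z1).
  have -> : (z + 1) / (1 - (z + 1)) - z / (1 - z) = ((1 - z) * - z)^-1.
    by field; repeat (apply/andP; split); apply/eqP => e; lra.
  by rewrite lef_pV2 ?posrE; nra.
have phi_le (z : R) : `|phi z| <= 6.
  rewrite /phi normrM ger0_norm// ler_piMr// normf_div ler_pdivrMr ?normr_gt0 ?gt_eqF//.
  by rewrite mul1r (ger0_norm (ltW (n0 z))) lerDr.
have tel : \sum_(j < M) gauss 2^-1 (y - j%:R) <= phi (M%:R - y) - phi (- y).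
  elim: M => [|M IH]; first by rewrite big_ord0 add0r subrr.
  rewrite big_ord_recr/=; apply: le_trans (lerD IH (_ : _ <= phi (M.+1%:R - y) - phi (M%:R - y))) _.
    have := step (M%:R - y); rewrite addrAC natr1; apply: le_trans.
    by rewrite /gauss -[X in X ^+ 2]opprB sqrrN.
  by rewrite addrC addrA subrK.
apply: le_trans tel _; have := phi_le (M%:R - y); have := phi_le (- y).
by rewrite !ler_norml => /andP[h1 h2] /andP[h3 h4]; lra.
Qed.

Lemma vgauss_prod n b (x : 'rV[R]_n) : vgauss b x = \prod_i gauss b (x 0 i).
Proof.
rewrite /vgauss /gauss /sqn mulr_sumr -sumrN.
by rewrite expR_sum.
Qed.

Variable k : nat.

Section grid.
Variable M : nat.
Definition grid_index : finType := ('I_M * {ffun 'I_k -> 'I_M})%type.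

(** The first coordinate starts at 1, which keeps the points away from the origin, and also sets the
    scale of the layer; the product index type lets sums of products factor. *)
Definition grid (i : grid_index) : 'rV[R]_k.+1 :=
  vcons (i.1.+1%:R) (\row_l (i.2 l)%:R).

Definition cone_point (i : grid_index) : 'rV[R]_k.+2 :=
  vcons (- enorm (grid i)) (grid i).

Lemma sqn_cone_point i : sqn (cone_point i) = 2 * sqn (grid i).
Proof. by rewrite sqn_vcons sqrrN sqr_enorm mulr2n mulrDl mul1r. Qed.

Lemma enorm_cone_point i : enorm (cone_point i) = Num.sqrt 2 * enorm (grid i).
Proof.
by rewrite {1}/enorm -[X in Num.sqrt X]/(sqn _) sqn_cone_point sqrtrM.
Qed.

Lemma cone_point_cone i :
  enorm (cone_point i) + dotR (vcons (Num.sqrt 2) 0) (cone_point i) = 0.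
Proof.
rewrite enorm_cone_point dotR_vcons vcons0 mulrN.
by rewrite /dotR big1 ?addr0 ?subrr// => j _; rewrite mxE mul0r.
Qed.

Lemma cone_point_ge1 i : 1 <= enorm (cone_point i).
Proof.
rewrite -(@ler_pXn2r _ 2)// ?nnegrE ?enorm_ge0// expr1n sqr_enorm sqn_cone_point sqn_vcons.
have h : 1 <= i.1.+1%:R ^+ 2 :> R by rewrite exprn_ege1// ler1n.
have := sqn_ge0 (\row_l (i.2 l)%:R : 'rV[R]_k); lra.
Qed.

(** The cone coordinate contributes a factor at most 1 and is dropped; the other [k.+1] coordinates
    range over a product, so the sum factors into one-dimensional sums. *)
Lemma sum_vgauss_cone_le xi :
  \sum_i vgauss 2^-1 (xi - cone_point i) <= 12 ^+ k.+1.
Proof.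
pose z : R := xi 0 (lift ord0 ord0) - 1.
pose w (l : 'I_k) : R := xi 0 (lift ord0 (lift ord0 l)).
apply: (@le_trans _ _ (\sum_(i : grid_index) gauss 2^-1 (z - i.1%:R) *
    \prod_l gauss 2^-1 (w l - (i.2 l)%:R))).
  apply: ler_sum => i _; rewrite vgauss_prod !big_ord_recl mulrA.
  have -> : \prod_(l < k) gauss 2^-1 ((xi - cone_point i) 0 (lift ord0 (lift ord0 l))) =
      \prod_l gauss 2^-1 (w l - (i.2 l)%:R).
    by apply: eq_bigr => l _; rewrite mxE mxE vconsS vconsS mxE.
  have -> : gauss 2^-1 ((xi - cone_point i) 0 (lift ord0 ord0)) = gauss 2^-1 (z - i.1%:R).
    rewrite mxE mxE vconsS vcons0 /z -natr1; congr gauss; ring.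
  apply: ler_wpM2r; first by apply: prodr_ge0 => l _; exact: gauss_ge0.
  rewrite ler_piMl ?gauss_ge0// /gauss -expR0 ler_expR oppr_le0 mulr_ge0 ?sqr_ge0//.
rewrite -(pair_bigA _ (fun (j : 'I_M) (f : {ffun 'I_k -> 'I_M}) => gauss 2^-1 (z - j%:R) *
    \prod_l gauss 2^-1 (w l - (f l)%:R)))/=.
under eq_bigr do rewrite -mulr_sumr.
rewrite -mulr_suml exprS -(bigA_distr_bigA (fun l (v : 'I_M) => gauss 2^-1 (w l - v%:R))).
have s0 (y : R) : 0 <= \sum_(j < M) gauss 2^-1 (y - j%:R).
  by apply: sumr_ge0 => j _; exact: gauss_ge0.
apply: ler_pM => //; first by apply: prodr_ge0.
  exact: sum_gauss_le.
rewrite -[X in _ ^+ X](card_ord k) -prodr_const; apply: ler_prod => l _.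
by rewrite s0 sum_gauss_le.
Qed.

(** In layer [j] only the points whose other coordinates are at most [j] are kept: there are
    [(j+1)^k] of them, of norm at most [c (j+1)] with [c^2 = 2 (k+1)], so the layer contributes at
    least [c^-(k+1) / (j+1)]. *)
Lemma sum_cone_ge :
  (Num.sqrt (2 * k.+1%:R) ^+ k.+1)^-1 * \sum_(j < M) j.+1%:R^-1 <=
  \sum_i (enorm (cone_point i) ^+ k.+1)^-1.
Proof.
rewrite mulr_sumr -(pair_bigA _ (fun (j : 'I_M) (f : {ffun 'I_k -> 'I_M}) =>
   (enorm (cone_point (j, f)) ^+ k.+1)^-1))/=.
apply: ler_sum => j _.
set c := Num.sqrt _.
have c0 : 0 < c by rewrite sqrtr_gt0 mulr_gt0.
pose P : {pred 'I_M} := [pred v : 'I_M | (v < j.+1)%N].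
rewrite (bigID (mem (ffun_on P)))/= -[leLHS]addr0; apply: lerD; last first.
  by apply: sumr_ge0 => f _; rewrite invr_ge0 exprn_ge0 ?enorm_ge0.
have cardP : #|P| = j.+1.
  rewrite -sum1_card -(big_ord_widen M (fun=> 1%N)) ?sum1_card ?card_ord//.
apply: (@le_trans _ _ (\sum_(f : {ffun 'I_k -> 'I_M} | f \in ffun_on P) ((c * j.+1%:R) ^+ k.+1)^-1)).
  rewrite sumr_const card_ffun_on cardP card_ord -[leRHS]mulr_natr natrX exprMn invfM -mulrA.
  apply: ler_wpM2l; first by rewrite invr_ge0 exprn_ge0// ltW.
  by rewrite exprS invfM -mulrA mulVf ?mulr1// expf_neq0.
apply: ler_sum => f /ffun_onP fP.
have q0 : 0 < enorm (cone_point (j, f)) by apply: lt_le_trans (cone_point_ge1 _).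
rewrite lef_pV2 ?posrE ?exprn_gt0// ?mulr_gt0//.
rewrite lerXn2r// ?nnegrE ?(ltW q0)// ?mulr_ge0 ?(ltW c0)//.
rewrite -(@ler_pXn2r _ 2)// ?nnegrE ?(ltW q0)// ?mulr_ge0 ?(ltW c0)//.
rewrite exprMn sqr_enorm sqn_cone_point sqr_sqrtr ?mulr_ge0// -mulrA.
rewrite ler_pM2l// sqn_vcons /=.
have -> : k.+1%:R * j.+1%:R ^+ 2 = j.+1%:R ^+ 2 + \sum_(l < k) j.+1%:R ^+ 2 :> R.
  by rewrite sumr_const card_ord -mulrS mulr_natl.
rewrite lerD2l; apply: ler_sum => l _; rewrite mxE lerXn2r// ?nnegrE ?ler0n// ler_nat.
by have := fP l; rewrite inE => /ltnW.
Qed.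

End grid.

Lemma harmonic_unbounded (B : R) : exists M, B < \sum_(j < M) j.+1%:R^-1.
Proof.
apply/not_existsP => h; apply: (@dvg_harmonic R); apply: nondecreasing_is_cvgn.
  by apply: nondecreasing_series => i _; rewrite invr_ge0.
exists B => _ [M _ <-]; rewrite /series/= big_mkord.
by have /negP := h M; rewrite -leNgt.
Qed.

End lattice.

(** The space-time norm is bounded below linearly in [S] and the Sobolev norm above by a multiple of
    [sqrt S], so [S] is bounded, uniformly over all finite families with the same overlap constant
    [kappa]. *)
Lemma strichartz_cone_bound (R : realType) m (V : 'rV[R]_m.+1) (kappa C : R) :
  (forall u : 'rV[R]_m.+1 -> R[i], schwartz u ->
     (L2Linf_norm (fun t => wave t u) <= (C * Hdot_norm ((m.+1%:R - 1) / 2) u)%:E)%E) ->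
  exists B : R, forall (I : finType) (p : I -> 'rV[R]_m.+1),
    (forall i, enorm (p i) + dotR V (p i) = 0) ->
    (forall i, 1 <= enorm (p i)) ->
    (forall xi, \sum_i vgauss 2^-1 (xi - p i) <= kappa) ->
    \sum_i (enorm (p i) ^+ m)^-1 <= B.
Proof.
move=> est; have [D D0 hD] := Hdot_packet_le m kappa.
pose Q := 4 * (1 + enorm V) ^+ 2 * Num.sqrt (pi / 4^-1 : R) ^+ m.+1.
pose A := Num.sqrt (pi / 2^-1 : R) ^+ m.+1.
have Q0 : 0 < Q.
  by rewrite !mulr_gt0 ?exprn_gt0 ?ltr_pwDl ?enorm_ge0// sqrtr_gt0 divr_gt0 ?pi_gt0.
have A0 : 0 < A by rewrite exprn_gt0// sqrtr_gt0 divr_gt0 ?pi_gt0.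
(* [d^2 Q = A] is the equality case of the condition on [t] in [wave_packet_ge]. *)
pose d := Num.sqrt (A / Q); have d0 : 0 < d by rewrite sqrtr_gt0 divr_gt0.
exists (2 * C ^+ 2 * D / d) => I p cone p1 pk.
pose a i := (enorm (p i) ^+ m)^-1; rewrite -[leLHS]/(\sum_i a i); set S := \sum_i a i.
have a0 i : 0 <= a i by rewrite invr_ge0 exprn_ge0 ?enorm_ge0.
have S0 : 0 <= S by apply: sumr_ge0.
have lower : ((S / 2 * Num.sqrt (2 * d))%:E <= L2Linf_norm (fun t => wave t (packet p a)))%E.
  apply: (@L2Linf_norm_ge _ _ _ (fun t => t *: V)) => //; first exact: divr_ge0.
  move=> t td; apply: wave_packet_ge => //.
  have t2 : t ^+ 2 <= A / Q.
    rewrite -[leRHS]sqr_sqrtr; last by rewrite divr_ge0// ltW.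
    by rewrite -(real_normK (num_real t)) lerXn2r// nnegrE ltW.
  rewrite -[leRHS]/A (_ : 4 * t ^+ 2 * _ * _ = t ^+ 2 * Q); last by rewrite /Q; ring.
  by rewrite -ler_pdivlMr.
have upper := hD I p p1 pk.
have : S / 2 * Num.sqrt (2 * d) <= `|C| * Num.sqrt (D * S).
  rewrite -lee_fin; apply: le_trans lower _; apply: le_trans (est _ (schwartz_packet p a)) _.
  rewrite lee_fin; apply: (@le_trans _ _ (`|C| * Hdot_norm ((m.+1%:R - 1) / 2) (packet p a))).
    by rewrite ler_wpM2r ?ler_norm// sqrtr_ge0.
  exact: ler_wpM2l.
rewrite -(@ler_pXn2r _ 2)// ?nnegrE ?mulr_ge0 ?sqrtr_ge0 ?invr_ge0//.
rewrite !exprMn !sqr_sqrtr ?mulr_ge0 ?(ltW D0) ?(ltW d0)// real_normK ?num_real//.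
(* The squared inequality reads [S^2 d / 2 <= C^2 D S]; a factor [S] has to be cancelled. *)
have [->|Sn0] := eqVneq S 0.
  by move=> _; rewrite divr_ge0 ?(ltW d0)// mulr_ge0 ?(ltW D0)// mulr_ge0 ?sqr_ge0.
have Sp : 0 < S by rewrite lt_neqAle eq_sym Sn0.
move=> h; rewrite ler_pdivlMr// -(ler_pM2l Sp).
by move: h; rewrite exprVn; nra.
Qed.

Theorem theorem1 (R : realType) (n : nat) : (4 <= n)%N ->
  ~ (exists C : R, forall u : 'rV[R]_n -> R[i], schwartz u ->
       (L2Linf_norm (fun t => wave t u) <= (C * Hdot_norm ((n%:R - 1) / 2) u)%:E)%E).
Proof.
case: n => [//|[//|k]] _ [C est].
have [B hB] := strichartz_cone_bound (vcons (Num.sqrt 2) 0) (12 ^+ k.+1) est.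
pose c : R := Num.sqrt (2 * k.+1%:R) ^+ k.+1.
have c0 : 0 < c by rewrite exprn_gt0// sqrtr_gt0 mulr_gt0.
have [M hM] := harmonic_unbounded (c * B).
have := hB _ (@cone_point R k M) (@cone_point_cone R k M) (@cone_point_ge1 R k M)
  (@sum_vgauss_cone_le R k M).
apply/negP; rewrite -ltNge; apply: lt_le_trans (sum_cone_ge R k M).
by rewrite -/c ltr_pdivlMl.
Qed.
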